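(* Let $d\ge 1$, $T>0$, $\omega>0$, and let $\boldsymbol{\epsilon}_1(\mathbf{x},t)=\boldsymbol{\epsilon}(\mathbf{x}|\mathbf{c},t)$ and $\boldsymbol{\epsilon}_2(\mathbf{x},t)=\boldsymbol{\epsilon}(\mathbf{x},t)$ be the optimal (infinitesimal time step) denoising functions on $\mathbb{R}^d\times[0,T]$ of the conditional density $p(\mathbf{x}|\mathbf{c})$ and of the unconditional density $p(\mathbf{x})$, as defined in the context; in particular both are solutions of the FP equation. Let $\Delta\mathbf{x}=\Delta\mathbf{x}(\mathbf{x},t)$ be a smooth $\mathbb{R}^d$-valued function satisfying $$\Delta \mathbf{x} = \left( \boldsymbol{\epsilon}_2( \mathbf{x}+(1+\omega)\Delta \mathbf{x}, t ) -\boldsymbol{\epsilon}_1( \mathbf{x} + \omega \Delta \mathbf{x}, t ) \right) \sigma(t),\qquad \sigma(t)=\sqrt{1-e^{-t}},$$ for all $(\mathbf{x},t)\in\mathbb{R}^d\times[0,T]$, and let $\boldsymbol{\epsilon}_{CH}$ be the characteristic guidance $$\boldsymbol{\epsilon}_{CH}(\mathbf{x}|\mathbf{c}, t, \omega) = (1+\omega)\,\boldsymbol{\epsilon}_1(\mathbf{x}+\omega\Delta\mathbf{x}, t)-\omega\,\boldsymbol{\epsilon}_2(\mathbf{x}+(1+\omega)\Delta\mathbf{x}, t).$$ Assume that the Harmonic Ansatz holds for $\boldsymbol{\epsilon}_1$, $\boldsymbol{\epsilon}_2$ and $\boldsymbol{\epsilon}_{CH}$, i.e. $\nabla_{\mathbf{x}}^2\boldsymbol{\epsilon}_1=\nabla_{\mathbf{x}}^2\boldsymbol{\epsilon}_2=\nabla_{\mathbf{x}}^2\boldsymbol{\epsilon}_{CH}=0$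 for all $\mathbf{x}\in\mathbb{R}^d$ and $t\in(0,T]$. Then the characteristic guidance has no mixing error: $$\mathbf{e}_m(\boldsymbol{\epsilon}_{CH},\mathbf{x},t)=0\qquad\text{for all }\mathbf{x}\in\mathbb{R}^d,\ t\in(0,T].$$
   Context: Notation: $\nabla_{\mathbf{x}}^2$ is the Laplacian in $\mathbf{x}$, applied componentwise to vector fields; $\|\cdot\|_2$ is the Euclidean norm; $\sigma(t)=\sqrt{1-e^{-t}}$. Optimal denoising functions. Given a probability density $p$ on $\mathbb{R}^d$, let $p_t$ be the density at time $t$ of the Ornstein–Uhlenbeck process $d\mathbf{x}_t=-\tfrac12\mathbf{x}_t\,dt+d\mathbf{W}_t$ started at $\mathbf{x}_0\sim p$, so that $\partial_t p_t=\tfrac12\nabla\cdot(\mathbf{x}p_t)+\tfrac12\nabla^2p_t$, $p_0=p$. Its score is $\mathbf{s}(\mathbf{x},t)=\nabla_{\mathbf{x}}\log p_t(\mathbf{x})$, and the optimal denoising function for infinitesimal time steps is $\boldsymbol{\epsilon}(\mathbf{x},t)=-\sigma(t)\,\mathbf{s}(\mathbf{x},t)$. The functions $\boldsymbol{\epsilon}(\mathbf{x}|\mathbf{c},t)$ and $\boldsymbol{\epsilon}(\mathbf{x},t)$ are obtained in this way from $p(\mathbf{x}|\mathbf{c})$ (a fixed condition $\mathbf{c}$) and $p(\mathbf{x})$ respectively. The densities are positive and the scores are assumed smooth on $\mathbb{R}^d\times[0,T]$. FP equation (for $t>0$): $$\frac{\partial \boldsymbol{\epsilon} }{\partial t} =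 \frac{1}{2} \left( \mathcal{L}\boldsymbol{\epsilon} - \frac{ 1 }{ \sigma(t)} \nabla_\mathbf{x} \| \boldsymbol{\epsilon} \|^2_2\right),\qquad \mathcal{L}\boldsymbol{\epsilon} = \nabla_\mathbf{x} (\boldsymbol{\epsilon}\cdot \mathbf{x}) + \nabla_\mathbf{x}^2 \boldsymbol{\epsilon} + \frac{1-\sigma(t)^2}{\sigma(t)^2 } \boldsymbol{\epsilon}.$$ Mixing error of a (sufficiently smooth) function $\boldsymbol{\epsilon}(\mathbf{x},t)$, $t>0$: $$\mathbf{e}_{m}(\boldsymbol{\epsilon},\mathbf{x},t) = \frac{\partial \boldsymbol{\epsilon} }{\partial t} - \frac{1}{2} \left( \mathcal{L}\boldsymbol{\epsilon} - \frac{ 1 }{ \sigma(t)} \nabla_\mathbf{x} \| \boldsymbol{\epsilon} \|^2_2 \right).$$ *)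

(* Defs.v *)
From HB Require Import structures.
From mathcomp Require Import all_boot all_order all_algebra.
From mathcomp Require Import all_classical all_reals all_analysis.

Set Implicit Arguments.
Unset Strict Implicit.
Unset Printing Implicit Defensive.

Import Order.TTheory GRing.Theory Num.Theory.
Import numFieldNormedType.Exports.

Local Open Scope classical_set_scope.
Local Open Scope ring_scope.

(** * Lebesgue measure on [R^n]

    Measure-theoretically, [R^n] is [n.-tuple R] with its product
    sigma-algebra; analytically it is ['rV[R]_n], which carries the normed
    space structure. [row_of_tuple] goes from the former to the latter. *)

Section product_tuple.
Context (dT : measure_display) (T : measurableType dT) (R : realType).

Definition tcons n (z : T * n.-tuple T) : n.+1.-tuple T :=
  [tuple of z.1 :: z.2].

Definition tsplit n (v : n.+1.-tuple T) : T * n.-tuple T :=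
  (tnth v ord0, [tuple of behead v]).

Lemma tconsK n : cancel (@tcons n) (@tsplit n).
Proof.
move=> [a v]; rewrite /tsplit /tcons /= (tnth_nth a) /=; congr pair.
exact/val_inj.
Qed.

Lemma measurable_tcons n : measurable_fun [set: T * n.-tuple T] (@tcons n).
Proof. by apply: measurable_cons. Qed.

Lemma measurable_tsplit n : measurable_fun [set: n.+1.-tuple T] (@tsplit n).
Proof.
have mh := @measurable_tnth _ T n.+1 ord0.
exact: (measurable_fun_pair mh (@measurable_behead _ T n)).
Qed.

Section product_tcons.
Variables (n : nat) (m1 : {sigma_finite_measure set T -> \bar R}).
Variable m2 : {sigma_finite_measure set (n.-tuple T) -> \bar R}.

Let prod : {measure set (T * n.-tuple T)%type -> \bar R} := (m1 \x m2)%E.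

Definition product_tcons := pushforward (m1 \x m2)%E (@tcons n).

Let product_tcons0 : product_tcons set0 = 0%E.
Proof. exact: (measure0 prod). Qed.

Let product_tcons_ge0 A : (0 <= product_tcons A)%E.
Proof. exact: (measure_ge0 prod). Qed.

Let product_tcons_sigma_additive : semi_sigma_additive product_tcons.
Proof.
move=> F mF tF mUF; rewrite /product_tcons /pushforward preimage_bigcup.
apply: (@measure_semi_sigma_additive _ _ _ prod).
- by move=> k; rewrite -[X in measurable X]setTI; exact: measurable_tcons.
- apply/trivIsetP => i j _ _ ij; rewrite -preimage_setI.
  by move/trivIsetP : tF => -> //; rewrite preimage_set0.
- by rewrite -preimage_bigcup -[X in measurable X]setTI;
    exact: measurable_tcons.
Qed.

HB.instance Definition _ := isMeasure.Build _ _ _ product_tcons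
  product_tcons0 product_tcons_ge0 product_tcons_sigma_additive.

Let product_tcons_sigma_finite : sigma_finite setT product_tcons.
Proof.
have /sigma_finiteP[F [TF ndF Foo]] := sigma_finiteT m1.
have /sigma_finiteP[G [TG ndG Goo]] := sigma_finiteT m2.
exists (fun k => @tsplit n @^-1` (F k `*` G k)).
  rewrite -preimage_bigcup -[LHS](preimage_setT (@tsplit n)); congr preimage.
  rewrite -setXTT TF TG predeqE => -[x y]; split.
    move=> [/= [i _ Fx] [k _ Gy]]; exists (maxn i k) => //; split.
    - by move: x Fx; exact/subsetPset/ndF/leq_maxl.
    - by move: y Gy; exact/subsetPset/ndG/leq_maxr.
  by move=> [i _ []/= ? ?]; split; exists i.
move=> k; have [mF Fk] := Foo k; have [mG Gk] := Goo k; split.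
  by rewrite -[X in measurable X]setTI; apply: measurable_tsplit => //;
    exact: measurableX.
rewrite /product_tcons /pushforward -comp_preimage.
have -> : @tsplit n \o @tcons n = id by apply/funext => z; exact: tconsK.
by rewrite preimage_id product_measure1E// lte_mul_pinfty// ge0_fin_numE.
Qed.

HB.instance Definition _ := Measure_isSigmaFinite.Build _ _ _ product_tcons
  product_tcons_sigma_finite.

End product_tcons.

(* The [n]-fold product of the measure [m]. *)
Fixpoint product_tuple (m : {sigma_finite_measure set T -> \bar R}) (n : nat) :
    {sigma_finite_measure set (n.-tuple T) -> \bar R} :=
  if n is n'.+1 then product_tcons m (product_tuple m n')
  else @dirac _ (0.-tuple T) [tuple] R.

End product_tuple.

Section lebesgue_tuple.
Context (R : realType).
Local Notation RM := (measurableTypeR R).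

Definition lebesgue_tuple (n : nat) :
    {sigma_finite_measure set (n.-tuple RM) -> \bar R} :=
  product_tuple (@lebesgue_measure R) n.

Definition row_of_tuple n (y : n.-tuple RM) : 'rV[R]_n := \row_i tnth y i.

End lebesgue_tuple.

(** * Vector calculus on [R^d] *)

Section calculus.
Context (R : realType) (d : nat).
Implicit Types (f : 'rV[R]_d -> R) (F : 'rV[R]_d -> 'rV[R]_d).

Definition dotmul (u v : 'rV[R]_d) : R := \sum_i u 0 i * v 0 i.

(* The norm [`|v|] of ['rV[R]_d] is the sup norm. *)
Definition norm2 (v : 'rV[R]_d) : R := Num.sqrt (dotmul v v).

Definition gradient f (x : 'rV[R]_d) : 'rV[R]_d :=
  \row_i 'D_(delta_mx 0 i) f x.

Definition laplacian F (x : 'rV[R]_d) : 'rV[R]_d :=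
  \sum_i 'D_(delta_mx 0 i) (fun y => 'D_(delta_mx 0 i) F y) x.

End calculus.

(** * Smooth functions

    A function on the closed strip [R^d x [0, T]] is smooth when near each
    point of the strip it is the restriction of a smooth function defined on
    an open set of [R^d x R]. *)

(* [f] is of class [C^k] on the open subset [U]. *)
Fixpoint class_C (R : realType) (V W : normedModType R) (k : nat)
    (U : set V) (f : V -> W) : Prop :=
  if k is k'.+1 then
    (forall z, U z -> differentiable f z) /\
    (forall v, class_C k' U (fun z => 'D_v f z))
  else forall z, U z -> {for z, continuous f}.

Definition smooth_on_strip (R : realType) (d : nat) (T : R)
    (f : 'rV[R]_d -> R -> 'rV[R]_d) : Prop :=
  forall x t, 0 <= t <= T ->
  exists (U : set ('rV[R]_d * R)%type) (g : 'rV[R]_d * R -> 'rV[R]_d),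
    [/\ open U, U (x, t), forall k, class_C k U g &
        forall y s, U (y, s) -> 0 <= s <= T -> f y s = g (y, s)].

(* Derivative in time of a function of [t] in [[0, T]]: at interior points this
   is the usual derivative, at [T] it is the left derivative. *)
Definition dtime (R : realType) (d : nat) (T : R)
    (f : 'rV[R]_d -> R -> 'rV[R]_d) (x : 'rV[R]_d) (t : R) : 'rV[R]_d :=
  lim ((s - t)^-1 *: (f x s - f x t)
         @[s --> within [set s | 0 <= s <= T] t^']).

(** * Optimal denoising functions *)

Section denoising.
Context (R : realType) (d : nat).

Definition sigma (t : R) : R := Num.sqrt (1 - expR (- t)).

Definition positive_density (p : 'rV[R]_d -> R) : Prop :=
  [/\ forall x, 0 < p x,
      measurable_fun setT (p \o @row_of_tuple R d) &
      (\int[lebesgue_tuple R d]_y (p (row_of_tuple y))%:E = 1)%E].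

(* Transition density, from [y] at time [0] to [x] at time [t > 0], of the
   Ornstein-Uhlenbeck process [dx = - x / 2 dt + dW]: given [x_0 = y], the
   vector [x_t] is Gaussian with mean [e^(-t/2) y] and covariance
   [(1 - e^(-t)) I]. *)
Definition ou_kernel (t : R) (x y : 'rV[R]_d) : R :=
  \prod_i normal_pdf (expR (- t / 2) * y 0 i) (sigma t) (x 0 i).

Definition ou_density (p : 'rV[R]_d -> R) (t : R) (x : 'rV[R]_d) : R :=
  if t == 0 then p x
  else \int[lebesgue_tuple R d]_y
         (ou_kernel t x (row_of_tuple y) * p (row_of_tuple y)).

Definition score (p : 'rV[R]_d -> R) (x : 'rV[R]_d) (t : R) : 'rV[R]_d :=
  gradient (fun y => ln (ou_density p t y)) x.

(* Differentiability guarantees that the total operator [gradient] in [score]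
   is a genuine gradient, including at [t = 0]. *)
Definition smooth_score (T : R) (p : 'rV[R]_d -> R) : Prop :=
  (forall x t, 0 <= t <= T ->
     differentiable (fun y => ln (ou_density p t y)) x) /\
  smooth_on_strip T (score p).

Definition optimal_denoiser (p : 'rV[R]_d -> R) (x : 'rV[R]_d) (t : R) :
  'rV[R]_d := - (sigma t *: score p x t).

Implicit Types (eps dx : 'rV[R]_d -> R -> 'rV[R]_d).

Definition FP_operator eps (x : 'rV[R]_d) (t : R) : 'rV[R]_d :=
  gradient (fun y => dotmul (eps y t) y) x + laplacian (eps ^~ t) x
  + ((1 - sigma t ^+ 2) / sigma t ^+ 2) *: eps x t.

Definition mixing_error (T : R) eps (x : 'rV[R]_d) (t : R) : 'rV[R]_d :=
  dtime T eps x t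
  - 2^-1 *: (FP_operator eps x t
             - (sigma t)^-1 *: gradient (fun y => norm2 (eps y t) ^+ 2) x).

Definition harmonic_ansatz (T : R) eps : Prop :=
  forall x t, 0 < t <= T -> laplacian (eps ^~ t) x = 0.

Definition characteristic_guidance (omega : R) (eps1 eps2 dx :
    'rV[R]_d -> R -> 'rV[R]_d) (x : 'rV[R]_d) (t : R) : 'rV[R]_d :=
  (1 + omega) *: eps1 (x + omega *: dx x t) t
  - omega *: eps2 (x + (1 + omega) *: dx x t) t.

End denoising.

(* Main.v *)
(**
  Completing the square in the Gaussian kernel writes [p_t] as an explicit
  factor times the exponential family [G(xi, tau) = E exp(xi.y - tau |y|^2)],
  taken at [xi = r x]. Differentiating [G] under the integral expresses the
  score [s], its (symmetric) Jacobian [J] and its time derivative through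
  moments of the tilted law; when the Laplacian of [s] vanishes these moments
  combine into [s_t = s / 2 + J (x + 2 s) / 2].

  Put [q = sigma^2], [a = x + omega dx], [b = x + (1 + omega) dx], [A = s1(a)],
  [B = s2(b)], [S = (1 + omega) A - omega B], so that [eps_CH = - sigma S]. The
  fixed point equation says [a + q A = b + q B = x + q S]. Differentiating it
  in [x] gives [M1 Da = M2 Db = P] with [Mi = I + q Ji] and [P = I + q J_S],
  while [(1 + omega) Da - omega Db = I]. Hence
  [P^T = P^T ((1 + omega) Da - omega Db)] is symmetric, because
  [P^T Da = Da^T M1 Da] and [P^T Db = Db^T M2 Db] are. Differentiating it in
  [t] gives vectors [eta], [zeta] with [M1 eta = M2 zeta = q E], where [E] is
  the defect [S_t - S / 2 - J_S (x + 2 S) / 2], and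
  [(1 + omega) eta - omega zeta = 0]; so [q E = ((1 + omega) Da^T - omega Db^T) q E
  = P ((1 + omega) eta - omega zeta) = 0]. No invertibility is needed. Vectors
  being rows, these products appear transposed below.
*)

Require Import Defs.
From HB Require Import structures.
From mathcomp Require Import all_boot all_order all_algebra.
From mathcomp Require Import all_classical all_reals all_analysis.
From mathcomp Require Import measurable_realfun ring lra.

Import Order.TTheory GRing.Theory Num.Theory.
Import numFieldNormedType.Exports.

Set Implicit Arguments.
Unset Strict Implicit.
Unset Printing Implicit Defensive.

Local Open Scope classical_set_scope.
Local Open Scope ring_scope.

(** * Directional derivatives *)

Section scalar_derivatives.
Context {R : realType} {V : normedModType R}.
Implicit Types (f g : V -> R) (x v : V).

Lemma is_derive_const (c : R) x v : is_derive x v (fun _ : V => c) 0.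
Proof. exact: is_derive_cst. Qed.

Lemma is_derive_add f g x v df dg : is_derive x v f df -> is_derive x v g dg ->
  is_derive x v (fun y => f y + g y) (df + dg).
Proof. exact: is_deriveD. Qed.

Lemma is_derive_sub f g x v df dg : is_derive x v f df -> is_derive x v g dg ->
  is_derive x v (fun y => f y - g y) (df - dg).
Proof. exact: is_deriveB. Qed.

Lemma is_derive_mul f g x v df dg : is_derive x v f df -> is_derive x v g dg ->
  is_derive x v (fun y => f y * g y) (df * g x + f x * dg).
Proof.
move=> fP gP; apply: is_derive_eq (is_deriveM fP gP) _.
by rewrite addrC mulrC.
Qed.

Lemma is_derive_mulr f x v df c : is_derive x v f df ->
  is_derive x v (fun y => f y * c) (df * c).
Proof.
move=> fP; apply: is_derive_eq (is_derive_mul fP (is_derive_cst c x v)) _.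
by rewrite mulr0 addr0.
Qed.

Lemma is_derive_mull f x v df c : is_derive x v f df ->
  is_derive x v (fun y => c * f y) (c * df).
Proof.
move=> fP; apply: is_derive_eq (is_derive_mul (is_derive_cst c x v) fP) _.
by rewrite mul0r add0r.
Qed.

Lemma is_derive_bigsum n (f : 'I_n -> V -> R) x v df :
  (forall i, is_derive x v (f i) (df i)) ->
  is_derive x v (fun y => \sum_i f i y) (\sum_i df i).
Proof.
move=> fP; have -> : (fun y => \sum_i f i y) = \sum_i f i.
  by apply/funext => y; rewrite fct_sumE.
exact: is_derive_sum.
Qed.

(** Both derivatives have the same difference quotient. Results on one real variable, such as the
    chain rule and differentiation under the integral sign, thereby transfer to directional
    derivatives. *)
Lemma is_derive_along (W : normedModType R) (f : V -> W) x v df :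
  is_derive x v f df <-> is_derive (0 : R) (1 : R) (fun h => f (h *: v + x)) df.
Proof.
have E : 'D_1 (fun h : R => f (h *: v + x)) 0 = 'D_v f x.
  rewrite /derive; set g1 := fun h => h^-1 *: _; set g2 := fun h => h^-1 *: _.
  suff -> : g1 = g2 by [].
  by apply/funext => h; rewrite /g1 /g2 /= addr0 scale0r add0r [_%:A]mulr1.
split=> -[H HE].
  by apply: DeriveDef; [exact/(derivable1P f x v).1|rewrite E].
by apply: DeriveDef; [exact/(derivable1P f x v).2|rewrite -E].
Qed.

Lemma is_derive_chain (F : R -> R) f x v dF df :
  is_derive (f x) (1 : R) F dF -> is_derive x v f df ->
  is_derive x v (fun y => F (f y)) (dF * df).
Proof.
move=> FP /is_derive_along fP; apply/is_derive_along.
have FP' : is_derive (f (0 *: v + x)) (1 : R) F dF by rewrite scale0r add0r.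
exact: (is_derive1_comp FP' fP).
Qed.

Lemma is_derive_div f g x v df dg : g x != 0 ->
  is_derive x v f df -> is_derive x v g dg ->
  is_derive x v (fun y => f y / g y) (df / g x - f x / g x * (dg / g x)).
Proof.
move=> g0 fP gP.
have iP : is_derive x v (fun y => (g y)^-1) (- (g x)^-2 * dg).
  apply: DeriveDef; first by apply: derivableV => //; exact: ex_derive.
  by rewrite deriveV // derive_val.
apply: is_derive_eq (is_derive_mul fP iP) _.
by rewrite -exprVn; ring.
Qed.

Lemma is_derive_continuous (F : R -> R) t dF :
  is_derive t (1 : R) F dF -> {for t, continuous F}.
Proof.
by move=> FP; apply/differentiable_continuous/derivable1_diffP; exact: ex_derive.
Qed.

End scalar_derivatives.

Section matrix_entries.
Context {R : pzRingType}.

Lemma addmxE m n (A B : 'M[R]_(m, n)) i j : (A + B) i j = A i j + B i j.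
Proof. by rewrite mxE. Qed.
Lemma oppmxE m n (A : 'M[R]_(m, n)) i j : (- A) i j = - A i j.
Proof. by rewrite mxE. Qed.
Lemma scalemxE m n (c : R) (A : 'M[R]_(m, n)) i j : (c *: A) i j = c * A i j.
Proof. by rewrite mxE. Qed.

Definition lmxE := (addmxE, oppmxE, scalemxE).

End matrix_entries.

(** * Derivatives of row-vector-valued functions, entry by entry *)

Section row_valued_derivatives.
Context {R : realType} {V : normedModType R} {d : nat}.
Implicit Types (x v : V) (F : V -> 'rV[R]_d).

Lemma is_derive_row F x v (dF : 'rV[R]_d) :
  (forall i, is_derive x v (fun y => F y 0 i) (dF 0 i)) -> is_derive x v F dF.
Proof.
move=> FP; have dF0 : derivable F x v.
  by apply/derivable_mxP => i j; rewrite ord1; exact: @ex_derive _ _ _ _ _ _ _ (FP j).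
apply: DeriveDef => //; rewrite derive_mx //; apply/rowP => i.
by rewrite mxE; exact: @derive_val _ _ _ _ _ _ _ (FP i).
Qed.

Lemma is_derive_entry F x v (dF : 'rV[R]_d) i :
  is_derive x v F dF -> is_derive x v (fun y => F y 0 i) (dF 0 i).
Proof.
move=> FP; have FD : derivable F x v by exact: ex_derive.
apply: DeriveDef; first by move/derivable_mxP: FD; apply.
by have := derive_mx FD; rewrite derive_val => ->; rewrite mxE.
Qed.

End row_valued_derivatives.

Section row_calculus.
Context {R : realType} {d : nat}.
Implicit Types (x v : 'rV[R]_d) (F : 'rV[R]_d -> 'rV[R]_d).

Lemma is_derive_coord x v i : is_derive x v (fun y : 'rV[R]_d => y 0 i) (v 0 i).
Proof.
apply/is_derive_along.
have -> : (fun h : R => (h *: v + x) 0 i) = (fun h => h * v 0 i + x 0 i).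
  by apply/funext => h; rewrite !mxE.
apply: is_derive_eq
  (is_derive_add (is_derive_mulr _ (is_derive_id _ _)) (is_derive_cst _ _ _)) _.
by rewrite mul1r addr0.
Qed.

Lemma sum_delta_row (F : 'I_d -> R) j : \sum_k (delta_mx 0 j : 'rV[R]_d) 0 k * F k = F j.
Proof.
rewrite (bigD1 j) //= mxE !eqxx mul1r big1 ?addr0 // => k kj.
by rewrite mxE (negbTE kj) andbF mul0r.
Qed.

(** The inner derivative in [laplacian] is a function that is differentiated again, so the first
    partials are required at every [y], the second ones only at [x]. *)
Lemma laplacian_entry F x (D : 'I_d -> 'I_d -> 'rV[R]_d -> R) (D2 : 'I_d -> 'I_d -> R) i :
  (forall y j k, is_derive y (delta_mx 0 j) (fun z => F z 0 k) (D j k y)) ->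
  (forall j k, is_derive x (delta_mx 0 j) (D j k) (D2 j k)) ->
  laplacian F x 0 i = \sum_j D2 j i.
Proof.
move=> FP DP; rewrite /laplacian summxE; apply: eq_bigr => j _.
have -> : (fun y => 'D_(delta_mx 0 j) F y) = (fun y => \row_k D j k y).
  apply/funext => y; apply: derive_val; apply: is_derive_row => k.
  by rewrite mxE.
have H : is_derive x (delta_mx 0 j : 'rV[R]_d)
    (fun y => \row_k D j k y : 'rV[R]_d) (\row_k D2 j k).
  apply: is_derive_row => k; rewrite mxE.
  by under eq_fun do rewrite mxE.
by rewrite derive_val mxE.
Qed.

End row_calculus.

(** * Exponentially tilted integrals *)

Section exponential_tilting.
Context {R : realType} {disp : measure_display} {Y : measurableType disp}.
Context {d : nat} (mu : {measure set Y -> \bar R}).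
Variables (Z : 'I_d -> Y -> R) (w : Y -> R).
Hypothesis mZ : forall i, measurable_fun setT (Z i).
Hypothesis iw : mu.-integrable setT (EFin \o w).

(** A class of integrands that is stable under multiplication by the [Z i], hence contains all
    monomials in them, and that the Gaussian factor in [tilt] dominates. *)
Definition exp_growth (h : Y -> R) : Prop :=
  measurable_fun setT h /\
  exists C c : R, forall y, `|h y| <= C * expR (c * \sum_i `|Z i y|).

Lemma exp_growth1 : exp_growth (cst 1).
Proof.
split; first exact: measurable_cst.
by exists 1, 0 => y; rewrite /= mul0r expR0 mulr1 normr1.
Qed.

Lemma exp_growthM h i : exp_growth h -> exp_growth (h \* Z i).
Proof.
move=> [mh [C [c hC]]]; split; first exact: measurable_funM.
(* The added 1 absorbs the new factor: [|Z i y| <= S <= exp S], where [S] is the sum of all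
   [|Z i y|]. *)
exists C, (c + 1) => y /=; rewrite normrM mulrDl mul1r expRD mulrA.
apply: ler_pM => //.
apply: (@le_trans _ _ (\sum_i `|Z i y|)).
  by rewrite (bigD1 i) //= lerDl sumr_ge0.
by apply: le_trans (expR_ge1Dx _); rewrite lerDr.
Qed.

Definition tilt (xi : 'I_d -> R) (tau : R) (y : Y) : R :=
  expR (\sum_i (xi i * Z i y - tau * Z i y ^+ 2)).

Lemma measurable_tilt xi tau : measurable_fun setT (tilt xi tau).
Proof.
apply: measurableT_comp => //; apply: measurable_sum => i.
apply: measurable_funB; first exact: measurable_funM.
by apply: measurable_funM => //; exact: measurable_funX.
Qed.

(** In each coordinate the exponent is at most [(|c| + M) |z| - tau0 |z|^2], whose maximum is the
    constant [b] found by completing the square. Uniformity in [xi] and [tau] is what makes this a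
    dominating bound for differentiation under the integral. *)
Lemma tilt_bounded h tau0 M : 0 < tau0 -> exp_growth h -> exists K, forall xi tau y,
  (forall i, `|xi i| <= M) -> tau0 <= tau -> `|h y * tilt xi tau y| <= K.
Proof.
move=> tau0_gt0 [mh [C [c hC]]].
pose b := (`|c| + M) ^+ 2 / (4 * tau0).
exists (`|C| * expR (\sum_(i < d) b)) => xi tau y xiM tau0_le.
rewrite normrM (ger0_norm (expR_ge0 _)).
apply: (@le_trans _ _ ((`|C| * expR (`|c| * \sum_i `|Z i y|)) * tilt xi tau y)).
  apply: ler_wpM2r; first exact: expR_ge0.
  apply: le_trans (hC y) _; apply: ler_pM; rewrite ?ler_norm ?expR_ge0 //.
    rewrite leNgt; apply/negP => C0.
    by have := le_trans (normr_ge0 _) (hC y); rewrite pmulr_lge0 ?expR_gt0 // leNgt C0.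
  by rewrite ler_expR ler_wpM2r ?sumr_ge0 // ler_norm.
rewrite -mulrA ler_wpM2l // -expRD ler_expR mulr_sumr -big_split /=.
apply: ler_sum => i _.
set z := Z i y; have xz : xi i * z <= M * `|z|.
  by apply: le_trans (ler_norm _) _; rewrite normrM ler_wpM2r.
have tz : tau0 * `|z| ^+ 2 <= tau * z ^+ 2.
  by rewrite real_normK ?num_real // ler_wpM2r ?sqr_ge0.
have bE : b * (4 * tau0) = (`|c| + M) ^+ 2.
  by rewrite /b divfK // gt_eqF // mulr_gt0.
have : 0 <= (2 * tau0 * `|z| - (`|c| + M)) ^+ 2 by exact: sqr_ge0.
rewrite -(@ler_pM2r _ (4 * tau0)) ?bE ?mulr_gt0 // => sq.
apply: le_trans (_ : (`|c| * `|z| + M * `|z| - tau0 * `|z| ^+ 2) * (4 * tau0) <= _).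
  by rewrite ler_wpM2r ?mulr_ge0 // ?(ltW tau0_gt0) //; lra.
lra.
Qed.

Definition tilted h xi tau : R := \int[mu]_y (h y * tilt xi tau y * w y).

Lemma integrable_tilted h xi tau : 0 < tau -> exp_growth h ->
  mu.-integrable setT (EFin \o (fun y => h y * tilt xi tau y * w y)).
Proof.
move=> tau0 hh.
have [K hK] := tilt_bounded (\sum_i `|xi i|) tau0 hh.
have := integrableZl measurableT K iw.
apply: le_integrable => //.
  apply/measurable_EFinP/measurable_funM; last first.
    by have /measurable_int/measurable_EFinP := iw.
  by apply: measurable_funM; [exact: hh.1|exact: measurable_tilt].
move=> y _ /=; rewrite lee_fin !normrM -normrM ler_wpM2r //.
apply: le_trans (hK xi tau y _ (lexx _)) (ler_norm _) => i.
by rewrite (bigD1 i) //= lerDl sumr_ge0.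
Qed.

Lemma Rintegral_sum n (F : 'I_n -> Y -> R) :
  (forall i, mu.-integrable setT (EFin \o F i)) ->
  \int[mu]_y (\sum_i F i y) = \sum_i \int[mu]_y F i y.
Proof.
move=> iF; rewrite /Rintegral sum_fine => [|i _]; last first.
  exact: (integrable_fin_num measurableT (iF i)).
rewrite -(integral_sum measurableT (f := fun i y => (F i y)%:E)) //.
by congr fine; apply: eq_integral => y _; rewrite sumEFin.
Qed.

(** Dominated differentiation under the integral: on an interval around [a] the parameters are
    bounded and [tau] stays away from 0, so [tilt_bounded] dominates the derivative of the integrand
    by a multiple of [|w|]. Moving both parameters along a path lets one lemma serve derivatives in
    space ([tau] constant) and in time. *)
Lemma is_derive_tilted h (xi dxi : 'I_d -> R -> R) (tau dtau : R -> R) (a : R) :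
  exp_growth h -> 0 < tau a ->
  (forall i, \forall t \near a, is_derive t (1 : R) (xi i) (dxi i t)) ->
  (\forall t \near a, is_derive t (1 : R) tau (dtau t)) ->
  (forall i, {for a, continuous (dxi i)}) -> {for a, continuous dtau} ->
  is_derive a (1 : R) (fun t => tilted h (xi^~ t) (tau t))
    (\sum_i (dxi i a * tilted (h \* Z i) (xi^~ a) (tau a)
             - dtau a * tilted (h \* Z i \* Z i) (xi^~ a) (tau a))).
Proof.
move=> hh tau0 dxiP dtauP cdxi cdtau.
have cxi i : {for a, continuous (xi i)}.
  exact: is_derive_continuous (nbhs_singleton (dxiP i)).
have ctau : {for a, continuous tau}.
  exact: is_derive_continuous (nbhs_singleton dtauP).
(* The summand 1 makes every bound by [M] strict at [a], so that continuity extends it to a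
   neighbourhood. *)
pose M := 1 + \sum_i (`|xi i a| + `|dxi i a|) + `|dtau a|.
have s0 : 0 <= \sum_i (`|xi i a| + `|dxi i a|) by apply: sumr_ge0 => i _; exact: addr_ge0.
have s1 i : `|xi i a| + `|dxi i a| <= \sum_i (`|xi i a| + `|dxi i a|).
  by rewrite [leRHS](bigD1 i) //= lerDl; apply: sumr_ge0 => j _; exact: addr_ge0.
have nM : \forall t \near a, [/\ forall i, is_derive t (1 : R) (xi i) (dxi i t) /\
      `|xi i t| <= M /\ `|dxi i t| <= M, is_derive t (1 : R) tau (dtau t),
      `|dtau t| <= M & tau a / 2 <= tau t].
  have n1 : \forall t \near a, forall i, is_derive t (1 : R) (xi i) (dxi i t) /\
      `|xi i t| <= M /\ `|dxi i t| <= M.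
    suff H i : \forall t \near a, is_derive t (1 : R) (xi i) (dxi i t) /\
      `|xi i t| <= M /\ `|dxi i t| <= M by exact: filter_forall H.
    have b1 : `|xi i a| < M.
      have := normr_ge0 (dxi i a); have := normr_ge0 (dtau a).
      by have := s1 i; rewrite /M; lra.
    have b2 : `|dxi i a| < M.
      have := normr_ge0 (xi i a); have := normr_ge0 (dtau a).
      by have := s1 i; rewrite /M; lra.
    near=> t; split; [|split]; near: t.
    - exact: dxiP.
    - exact: cvgr_norm_le _ (cxi i) _ b1.
    - exact: cvgr_norm_le _ (cdxi i) _ b2.
  have b3 : `|dtau a| < M by rewrite /M; lra.
  have b4 : tau a / 2 < tau a by lra.
  near=> t; split; near: t.
  - exact: n1.
  - exact: dtauP.
  - exact: (cvgr_norm_le _ cdtau _ b3).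
  - exact: (cvgr_ge _ ctau _ b4).
have /nbhs_ballP[e /= e0 eM] := nM.
pose I : set R := [set` `](a - e), (a + e)[].
have inI t : I t -> ball a e t.
  by rewrite /I /= in_itv /= => /andP[]; rewrite -ball_normE /= ltr_distlC => -> ->.
have {}eM t (It : I t) := eM t (inI t It).
have Ia : I a by rewrite /I /= in_itv /= ltrBlDr !ltrDl e0.
pose f t y := h y * tilt (xi^~ t) (tau t) y * w y.
pose df t y := \sum_i (dxi i t * ((h \* Z i) y * tilt (xi^~ t) (tau t) y * w y)
   - dtau t * ((h \* Z i \* Z i) y * tilt (xi^~ t) (tau t) y * w y)).
have fP t y : I t -> is_derive t (1 : R) (f ^~ y) (df t y).
  move=> /eM[xiP tauP _ _].
  rewrite /f /tilt; apply: is_derive_eq.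
    apply: is_derive_mulr; apply: is_derive_mull.
    apply: (is_derive_chain (is_derive_expR _)).
    apply: is_derive_bigsum => i.
    exact: (is_derive_sub (is_derive_mulr _ (xiP i).1) (is_derive_mulr _ tauP)).
  rewrite mulr_sumr mulr_sumr mulr_suml; apply: eq_bigr => i _ /=.
  by rewrite /tilt; ring.
have tau_gt0 t : I t -> 0 < tau t.
  by move=> /eM[_ _ _]; apply: lt_le_trans; rewrite divr_gt0.
have tau20 : 0 < tau a / 2 by rewrite divr_gt0.
have hZ i : exp_growth (h \* Z i) := exp_growthM i hh.
have hZZ i : exp_growth (h \* Z i \* Z i) := exp_growthM i (hZ i).
have /choice[K1 K1P] := fun i => tilt_bounded M tau20 (hZ i).
have /choice[K2 K2P] := fun i => tilt_bounded M tau20 (hZZ i).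
pose G y := (M * \sum_i (`|K1 i| + `|K2 i|)) * `|w y|.
have M0 : 0 <= M by rewrite /M addr_ge0 // addr_ge0.
have intG : mu.-integrable setT (EFin \o G).
  have := integrable_norm iw.
  by move=> /(integrableZl measurableT (M * \sum_i (`|K1 i| + `|K2 i|))).
have intf t : I t -> mu.-integrable setT (EFin \o f t).
  by move=> /tau_gt0 ?; exact: integrable_tilted.
have G0 y : 0 <= G y.
  rewrite mulr_ge0 // mulr_ge0 //; apply: sumr_ge0 => i _; exact: addr_ge0.
have derf1 t y : I t -> [set: Y] y -> derivable (f ^~ y) t 1.
  by move=> /fP H _; exact: ex_derive.
have dfE t y : I t -> partial1of2 f t y = df t y.
  by move=> /fP H; rewrite partial1of2E derive_val.
have G_ub t y : I t -> [set: Y] y -> `|partial1of2 f t y| <= G y.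
  move=> It _; rewrite dfE //; have [xiP _ dtM ttau] := eM t It.
  apply: le_trans (ler_norm_sum _ _ _) _.
  rewrite /G mulr_sumr mulr_suml; apply: ler_sum => i _.
  apply: le_trans (ler_normB _ _) _.
  rewrite mulrDr mulrDl !(mulrA _ (_ * tilt _ _ _)) !(normrM _ (w y)).
  apply: lerD; apply: ler_wpM2r => //; rewrite normrM; apply: ler_pM => //.
  - exact: (xiP i).2.2.
  - by apply: le_trans (ler_norm _); apply: K1P => // j; exact: (xiP j).2.1.
  - by apply: le_trans (ler_norm _); apply: K2P => // j; exact: (xiP j).2.1.
have := cvg_differentiation_under_integral measurableT Ia intf derf1 G0 intG G_ub.
have -> : \int[mu]_y partial1of2 f a y =
  \sum_i (dxi i a * tilted (h \* Z i) (xi^~ a) (tau a)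
             - dtau a * tilted (h \* Z i \* Z i) (xi^~ a) (tau a)).
  under eq_Rintegral do rewrite dfE //.
  have i1 i : mu.-integrable setT
      (EFin \o (fun y => dxi i a * ((h \* Z i) y * tilt (xi^~ a) (tau a) y * w y))).
    have := integrable_tilted (xi^~a) tau0 (hZ i).
    by move=> /(integrableZl measurableT (dxi i a)).
  have i2 i : mu.-integrable setT
      (EFin \o (fun y => dtau a * ((h \* Z i \* Z i) y * tilt (xi^~ a) (tau a) y * w y))).
    have := integrable_tilted (xi^~a) tau0 (hZZ i).
    by move=> /(integrableZl measurableT (dtau a)).
  rewrite Rintegral_sum; last by move=> i; exact: integrableB (i1 i) (i2 i).
  apply: eq_bigr => i _; rewrite RintegralB //.
  by rewrite !RintegralZl //; exact: integrable_tilted.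
move=> H; apply: DeriveDef.
  apply/cvg_ex; eexists => /=; under eq_fun do rewrite [_%:A]mulr1; exact: H.
by rewrite -derive1E; apply: cvg_lim => //; exact: H.
Unshelve. all: by end_near. Qed.

End exponential_tilting.

(** * Means and covariances under the tilted probability law *)

Section tilted_mean.
Context {R : realType} {disp : measure_display} {Y : measurableType disp}.
Context {d : nat} (mu : {measure set Y -> \bar R}).
Variables (Z : 'I_d -> Y -> R) (w : Y -> R).
Hypothesis mZ : forall i, measurable_fun setT (Z i).
Hypothesis iw : mu.-integrable setT (EFin \o w).
Hypothesis w_gt0 : forall y, 0 < w y.
Hypothesis int_w : (\int[mu]_y (w y)%:E = 1)%E.

Local Notation tilted := (tilted mu Z w).

(** A nonnegative integrand with zero integral vanishes almost everywhere. Here it is positive at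
    every point, so [w] would agree almost everywhere with 0, against its total mass 1. *)
Lemma tilted1_gt0 xi tau : 0 < tau -> 0 < tilted (cst 1) xi tau.
Proof.
move=> tau0.
pose f y := (cst 1 : Y -> R) y * tilt Z xi tau y * w y.
have f_gt0 y : 0 < f y by rewrite /f /= mul1r mulr_gt0 // expR_gt0.
have if_ := integrable_tilted mZ iw xi tau0 (exp_growth1 Z).
have mf : measurable_fun setT (EFin \o f) := measurable_int mu if_.
rewrite lt_neqAle eq_sym; apply/andP; split; last first.
  by apply: Rintegral_ge0 => y _; exact/ltW/f_gt0.
apply/eqP => f0.
have : (\int[mu]_y `|(f y)%:E| = 0)%E.
  under eq_integral do rewrite gee0_abs ?lee_fin ?(ltW (f_gt0 _)) //.
  by rewrite -(fineK (integrable_fin_num measurableT if_)); congr EFin.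
move=> /(ae_eq_integral_abs mu measurableT mf) f_ae0.
have w_ae0 : ae_eq mu setT (EFin \o w) (cst 0%E).
  apply: filterS f_ae0 => y /(_ I) /= [] fy0.
  by have := f_gt0 y; rewrite fy0 ltxx.
have mw : measurable_fun setT (EFin \o w) := measurable_int mu iw.
have : (\int[mu]_y (EFin \o w) y = \int[mu]_y cst 0 y)%E.
  by apply: ae_eq_integral.
by rewrite integral0 int_w => /eqP; rewrite onee_eq0.
Qed.

Definition tilted_mean h xi tau := tilted h xi tau / tilted (cst 1) xi tau.

Definition tilted_cov h g xi tau :=
  tilted_mean (h \* g) xi tau - tilted_mean h xi tau * tilted_mean g xi tau.

(** The quotient rule subtracts the product of the means from each mixed moment. This is the usual
    rule for an exponential family: differentiating a mean in a natural parameter gives the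
    covariance with its sufficient statistic. *)
Lemma is_derive_tilted_mean h (xi dxi : 'I_d -> R -> R) (tau dtau : R -> R) (a : R) :
  exp_growth Z h -> 0 < tau a ->
  (forall i, \forall t \near a, is_derive t (1 : R) (xi i) (dxi i t)) ->
  (\forall t \near a, is_derive t (1 : R) tau (dtau t)) ->
  (forall i, {for a, continuous (dxi i)}) -> {for a, continuous dtau} ->
  is_derive a (1 : R) (fun t => tilted_mean h (xi^~ t) (tau t))
    (\sum_i (dxi i a * tilted_cov h (Z i) (xi^~ a) (tau a)
             - dtau a * tilted_cov h (Z i \* Z i) (xi^~ a) (tau a))).
Proof.
move=> hh tau0 dxiP dtauP cdxi cdtau.
have G0 := lt0r_neq0 (tilted1_gt0 (xi^~ a) tau0).
have G1 := is_derive_tilted mZ iw (exp_growth1 Z) tau0 dxiP dtauP cdxi cdtau.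
have Gh := is_derive_tilted mZ iw hh tau0 dxiP dtauP cdxi cdtau.
apply: is_derive_eq (is_derive_div _ Gh G1) _ => /=; first exact: G0.
rewrite !mulr_suml mulr_sumr -sumrB; apply: eq_bigr => i _.
have e1 : cst 1 \* Z i = Z i by apply/funext => y; rewrite /= mul1r.
have e2 : h \* Z i \* Z i = h \* (Z i \* Z i) by apply/funext => y; rewrite /= mulrA.
rewrite e1 e2 /tilted_cov /tilted_mean.
by field.
Qed.

End tilted_mean.

(** * The score of the Ornstein-Uhlenbeck density *)

Section ornstein_uhlenbeck.
Context {R : realType} {d : nat}.
Variable p : 'rV[R]_d -> R.
Hypothesis density_p : positive_density p.
Implicit Types (x v : 'rV[R]_d) (t : R).

Local Notation RM := (measurableTypeR R).

Definition coord (i : 'I_d) (y : d.-tuple RM) : R := tnth y i.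

Lemma measurable_coord i : measurable_fun setT (coord i).
Proof. exact: measurable_tnth. Qed.

Lemma exp_growth_coord i : exp_growth coord (coord i).
Proof.
have := exp_growthM measurable_coord i (exp_growth1 coord).
by congr (exp_growth _ _); apply/funext => y; rewrite /= mul1r.
Qed.

(** With [q = ou_var t], expanding [-(x - e^(-t/2) y)^2 / (2 q)] leaves the cross term
    [ou_rate t * x * y] and the quadratic term [- ou_prec t * y^2]. *)
Definition ou_var t : R := 1 - expR (- t).
Definition ou_rate t : R := expR (- t / 2) / ou_var t.
Definition ou_prec t : R := expR (- t) / (2 * ou_var t).

Lemma ou_var_gt0 t : 0 < t -> 0 < ou_var t.
Proof. by move=> t0; rewrite subr_gt0 -expR0 ltr_expR oppr_lt0. Qed.

Lemma sigma_sqr t : 0 <= t -> sigma t ^+ 2 = ou_var t.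
Proof. by move=> t0; rewrite sqr_sqrtr // subr_ge0 -expR0 ler_expR oppr_le0. Qed.

Lemma sigma_gt0 t : 0 < t -> 0 < sigma t.
Proof. by move=> t0; rewrite sqrtr_gt0; exact: ou_var_gt0. Qed.

Lemma ou_prec_gt0 t : 0 < t -> 0 < ou_prec t.
Proof. by move=> t0; rewrite divr_gt0 ?expR_gt0 // mulr_gt0 // ou_var_gt0. Qed.

Lemma expR_half t : expR (- t / 2) ^+ 2 = expR (- t).
Proof. by rewrite expr2 -expRD; congr expR; field. Qed.

Let w (y : d.-tuple RM) : R := p (row_of_tuple y).

Let w_gt0 y : 0 < w y.
Proof. by have [+ _ _] := density_p; apply. Qed.

Let int_w : (\int[lebesgue_tuple R d]_y (w y)%:E = 1)%E.
Proof. by have [_ _] := density_p. Qed.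

Let iw : (lebesgue_tuple R d).-integrable setT (EFin \o w).
Proof.
have [_ mp _] := density_p.
apply/integrableP; split; first exact/measurable_EFinP.
under eq_integral do rewrite gee0_abs ?lee_fin ?(ltW (w_gt0 _)) //.
by rewrite int_w ltry.
Qed.

(** * The posterior law of the initial point given the position at time [t] *)

Local Notation tilted := (tilted (lebesgue_tuple R d) coord w).

(** For [t > 0] this is, by Bayes' rule, the conditional expectation of [h(x_0)] given [x_t = x]:
    the part of the kernel depending on [x] alone cancels in the quotient. *)
Definition post_mean h t x : R :=
  tilted_mean (lebesgue_tuple R d) coord w h
    (fun i => ou_rate t * x 0 i) (ou_prec t).

Definition post_cov h g t x : R :=
  tilted_cov (lebesgue_tuple R d) coord w h g
    (fun i => ou_rate t * x 0 i) (ou_prec t).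

Lemma ou_kernel_tilt t x (y : d.-tuple RM) : 0 < t ->
  ou_kernel t x (row_of_tuple y) =
  normal_peak (sigma t) ^+ d * expR (- (\sum_i x 0 i ^+ 2) / (2 * ou_var t)) *
  tilt coord (fun i => ou_rate t * x 0 i) (ou_prec t) y.
Proof.
move=> t0; rewrite /ou_kernel /tilt.
have q0 := ou_var_gt0 t0.
under eq_bigr => i _.
  rewrite normal_pdfE ?(lt0r_neq0 (sigma_gt0 t0)) // /row_of_tuple mxE /normal_fun.
  rewrite sigma_sqr ?ltW //.
  over.
rewrite big_split /= prodr_const card_ord -mulrA; congr (_ * _).
rewrite -expR_sum -expRD; congr expR.
rewrite -sumrN mulr_suml -big_split /=; apply: eq_bigr => i _.
rewrite /ou_rate /ou_prec -expR_half /coord.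
by field; exact: lt0r_neq0.
Qed.

Lemma ou_density_tilted t x : 0 < t ->
  ou_density p t x =
  normal_peak (sigma t) ^+ d * expR (- (\sum_i x 0 i ^+ 2) / (2 * ou_var t)) *
  tilted (cst 1) (fun i => ou_rate t * x 0 i) (ou_prec t).
Proof.
move=> t0; rewrite /ou_density (gt_eqF t0) -RintegralZl //; last first.
  exact: (integrable_tilted measurable_coord iw _ (ou_prec_gt0 t0) (exp_growth1 _)).
apply: eq_Rintegral => y _; rewrite ou_kernel_tilt // /w /= mul1r.
by rewrite !mulrA.
Qed.

Let affine_path t x v i (h : R) : R := ou_rate t * (h *: v + x) 0 i.

Let is_derive_affine_path t x v i (h : R) :
  is_derive h (1 : R) (affine_path t x v i) (ou_rate t * v 0 i).
Proof.
have -> : affine_path t x v i = (fun h => ou_rate t * (h * v 0 i + x 0 i)).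
  by apply/funext => k; rewrite /affine_path !mxE.
apply: is_derive_eq (is_derive_mull _
  (is_derive_add (is_derive_mulr _ (is_derive_id _ _)) (is_derive_cst _ _ _))) _.
by rewrite mul1r addr0.
Qed.

Let near_affine_path t x v i : \forall h \near (0 : R),
  is_derive h (1 : R) (affine_path t x v i) (ou_rate t * v 0 i).
Proof. by near=> h; exact: is_derive_affine_path. Unshelve. all: by end_near. Qed.

Let near_cst (c : R) : \forall h \near (0 : R), is_derive h (1 : R) (cst c) 0.
Proof. by near=> h; exact: is_derive_cst. Unshelve. all: by end_near. Qed.

Let affine_path0 t x v : (affine_path t x v)^~ 0 = (fun i => ou_rate t * x 0 i).
Proof. by apply/funext => j; rewrite /affine_path scale0r add0r. Qed.

Lemma is_derive_tilted1_space t x v : 0 < t ->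
  is_derive x v
    (fun y => tilted (cst 1) (fun i => ou_rate t * y 0 i) (ou_prec t))
    (ou_rate t * \sum_i v 0 i *
       tilted (coord i) (fun i => ou_rate t * x 0 i) (ou_prec t)).
Proof.
move=> t0; apply/is_derive_along.
apply: is_derive_eq.
  apply: (is_derive_tilted (tau := cst (ou_prec t)) (dtau := cst 0)
      (xi := affine_path t x v) (dxi := fun i => cst (ou_rate t * v 0 i))
      measurable_coord iw (exp_growth1 _)).
  - exact: ou_prec_gt0.
  - exact: near_affine_path.
  - exact: near_cst.
  - by move=> i; exact: cst_continuous.
  - exact: cst_continuous.
have e i : cst 1 \* coord i = coord i by apply/funext => y; rewrite /= mul1r.
rewrite affine_path0 mulr_sumr; apply: eq_bigr => i _.
by rewrite mul0r subr0 -mulrA e.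
Qed.

Lemma is_derive_post_mean_space h t x v : exp_growth coord h -> 0 < t ->
  is_derive x v (post_mean h t) (ou_rate t * \sum_i v 0 i * post_cov h (coord i) t x).
Proof.
move=> hh t0; apply/is_derive_along.
apply: is_derive_eq.
  apply: (is_derive_tilted_mean (tau := cst (ou_prec t)) (dtau := cst 0)
      (xi := affine_path t x v) (dxi := fun i => cst (ou_rate t * v 0 i))
      measurable_coord iw w_gt0 int_w hh).
  - exact: ou_prec_gt0.
  - exact: near_affine_path.
  - exact: near_cst.
  - by move=> i; exact: cst_continuous.
  - exact: cst_continuous.
rewrite affine_path0 mulr_sumr; apply: eq_bigr => i _.
by rewrite mul0r subr0 -mulrA.
Qed.

Lemma is_derive_post_mean_time h t x (dr dtau : R -> R) : exp_growth coord h -> 0 < t ->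
  (\forall s \near t, is_derive s (1 : R) ou_rate (dr s)) ->
  (\forall s \near t, is_derive s (1 : R) ou_prec (dtau s)) ->
  {for t, continuous dr} -> {for t, continuous dtau} ->
  is_derive t (1 : R) (fun s => post_mean h s x)
    (\sum_i (dr t * x 0 i * post_cov h (coord i) t x
             - dtau t * post_cov h (coord i \* coord i) t x)).
Proof.
move=> hh t0 drP dtauP cdr cdtau.
apply: (is_derive_tilted_mean (tau := ou_prec) (dtau := dtau)
      (xi := fun i s => ou_rate s * x 0 i) (dxi := fun i s => dr s * x 0 i)
      measurable_coord iw w_gt0 int_w hh) => //.
- exact: ou_prec_gt0.
- by move=> i; apply: filterS drP => s; exact: is_derive_mulr.
- by move=> i; apply: continuousM => //; exact: cst_continuous.
Qed.

Let gt0 t x (t0 : 0 < t) :=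
  tilted1_gt0 measurable_coord iw w_gt0 int_w (fun i => ou_rate t * x 0 i) (ou_prec_gt0 t0).

(** Tweedie's formula: the logarithm of the explicit Gaussian factor contributes [- x / q], and the
    logarithmic derivative of the normalising integral is [ou_rate t] times the posterior mean. *)
Lemma score_entry t x i : 0 < t ->
  score p x t 0 i = - (x 0 i / ou_var t) + ou_rate t * post_mean (coord i) t x.
Proof.
move=> t0; rewrite /score /gradient mxE; apply: derive_val.
have q0 := lt0r_neq0 (ou_var_gt0 t0).
have G0 := gt0 x t0.
have N0 : 0 < normal_peak (sigma t) ^+ d :> R.
  by rewrite exprn_gt0 // normal_peak_gt0 // lt0r_neq0 // sigma_gt0.
have -> : (fun y => ln (ou_density p t y)) = (fun y => ln (
  normal_peak (sigma t) ^+ d * expR (- (\sum_i y 0 i ^+ 2) / (2 * ou_var t)) *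
  tilted (cst 1) (fun i => ou_rate t * y 0 i) (ou_prec t))).
  by apply/funext => y; rewrite ou_density_tilted.
have dG := is_derive_tilted1_space x (delta_mx 0 i) t0.
have dE : is_derive x (delta_mx 0 i : 'rV[R]_d)
    (fun y : 'rV[R]_d => - (\sum_j y 0 j ^+ 2) / (2 * ou_var t)) (- (x 0 i / ou_var t)).
  have -> : (fun y : 'rV[R]_d => - (\sum_j y 0 j ^+ 2) / (2 * ou_var t)) =
     (fun y : 'rV[R]_d => (\sum_j y 0 j * y 0 j) * (- (2 * ou_var t)^-1)).
    apply/funext => y; rewrite mulrN mulNr; congr (- (_ * _)).
  apply: is_derive_eq.
    apply: is_derive_mulr; apply: is_derive_bigsum => j.
    exact: is_derive_mul (is_derive_coord _ _ _) (is_derive_coord _ _ _).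
  rewrite /= (eq_bigr (fun j => (delta_mx 0 i : 'rV[R]_d) 0 j * (2 * x 0 j))).
    by rewrite sum_delta_row; field.
  by move=> j _; ring.
apply: is_derive_eq.
  apply: (is_derive_chain (is_derive1_ln _)).
    by rewrite mulr_gt0 // mulr_gt0 // expR_gt0.
  apply: is_derive_mul dG.
  by apply: is_derive_mull; exact: is_derive_chain (is_derive_expR _) dE.
rewrite /= sum_delta_row /post_mean /tilted_mean.
by field; rewrite q0 !gt_eqF // expR_gt0.
Qed.

Lemma is_derive_score_space t x v i : 0 < t ->
  is_derive x v (fun y => score p y t 0 i)
    (- (v 0 i / ou_var t) + ou_rate t * (ou_rate t *
       \sum_k v 0 k * post_cov (coord i) (coord k) t x)).
Proof.
move=> t0.
have -> : (fun y => score p y t 0 i) =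
    (fun y : 'rV[R]_d => y 0 i * - (ou_var t)^-1 + ou_rate t * post_mean (coord i) t y).
  by apply/funext => y; rewrite score_entry // mulrN.
rewrite -mulrN; apply: is_derive_add.
  by apply: is_derive_mulr; exact: is_derive_coord.
by apply: is_derive_mull; apply: is_derive_post_mean_space => //; exact: exp_growth_coord.
Qed.

Lemma post_covE h g t x : post_cov h g t x =
  post_mean (h \* g) t x - post_mean h t x * post_mean g t x.
Proof. by []. Qed.

Lemma post_covC h g t x : post_cov h g t x = post_cov g h t x.
Proof.
rewrite /post_cov /tilted_cov mulrC; congr (tilted_mean _ _ _ _ _ _ - _).
by apply/funext => y /=; rewrite mulrC.
Qed.

(** The bracket is the third joint cumulant of the coordinates [i, j, j] under the posterior law. *)
Lemma is_derive_post_cov_space t x i j : 0 < t ->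
  is_derive x (delta_mx 0 j : 'rV[R]_d) (post_cov (coord i) (coord j) t)
    (ou_rate t * (post_cov (coord i) (coord j \* coord j) t x
       - 2 * post_cov (coord i) (coord j) t x * post_mean (coord j) t x)).
Proof.
move=> t0.
have hP := is_derive_post_mean_space x (delta_mx 0 j)
  (exp_growthM measurable_coord j (exp_growth_coord i)) t0.
have mP k := is_derive_post_mean_space x (delta_mx 0 j) (exp_growth_coord k) t0.
apply: is_derive_eq (is_derive_sub hP (is_derive_mul (mP i) (mP j))) _.
rewrite !sum_delta_row !post_covE.
have -> : coord i \* coord j \* coord j = coord i \* (coord j \* coord j).
  by apply/funext => y /=; rewrite mulrA.
by ring.
Qed.

(** The linear part of the score has no second derivatives, so only third cumulants remain. The
    Harmonic Ansatz thus becomes a relation between moments, the one that closes the time evolution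
    of the score. *)
Lemma laplacian_optimal_denoiser t x i : 0 < t ->
  laplacian (optimal_denoiser p ^~ t) x 0 i = - (sigma t * ou_rate t ^+ 3 *
    \sum_j (post_cov (coord i) (coord j \* coord j) t x
            - 2 * post_cov (coord i) (coord j) t x * post_mean (coord j) t x)).
Proof.
move=> t0.
pose D j k y := - sigma t * (- ((delta_mx 0 j : 'rV[R]_d) 0 k / ou_var t)
  + ou_rate t * (ou_rate t * post_cov (coord k) (coord j) t y)).
pose D2 j k := - sigma t * (ou_rate t * (ou_rate t * (ou_rate t *
  (post_cov (coord k) (coord j \* coord j) t x
   - 2 * post_cov (coord k) (coord j) t x * post_mean (coord j) t x)))).
have DP y j k : is_derive y (delta_mx 0 j : 'rV[R]_d)
    (fun z => optimal_denoiser p z t 0 k) (D j k y).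
  have -> : (fun z => optimal_denoiser p z t 0 k) =
      (fun z => - sigma t * score p z t 0 k).
    by apply/funext => z; rewrite !mxE mulNr.
  apply: is_derive_mull; apply: is_derive_eq (is_derive_score_space _ _ _ t0) _.
  by rewrite sum_delta_row.
have D2P j k : is_derive x (delta_mx 0 j : 'rV[R]_d) (D j k) (D2 j k).
  have covP := is_derive_mull (ou_rate t)
    (is_derive_mull (ou_rate t) (is_derive_post_cov_space x k j t0)).
  have cP := is_derive_const (- ((delta_mx 0 j : 'rV[R]_d) 0 k / ou_var t)) x
    (delta_mx 0 j : 'rV[R]_d).
  apply: is_derive_eq (is_derive_mull (- sigma t) (is_derive_add cP covP)) _.
  by rewrite add0r.
rewrite (laplacian_entry i DP D2P).
by rewrite mulr_sumr -sumrN; apply: eq_bigr => j _; rewrite /D2; ring.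
Qed.

(** * Time derivatives of the coefficients *)

Let is_derive_expRN (t : R) : is_derive t (1 : R) (fun s => expR (- s)) (- expR (- t)).
Proof.
apply: is_derive_eq (is_derive_chain (is_derive_expR _) (is_deriveNid t (1 : R))) _.
by rewrite mulrN1.
Qed.

Lemma is_derive_ou_var t : is_derive t (1 : R) ou_var (1 - ou_var t).
Proof.
apply: is_derive_eq (is_derive_sub (is_derive_const 1 _ _) (is_derive_expRN t)) _.
by rewrite /ou_var; ring.
Qed.

Lemma is_derive_ou_rate t : 0 < t ->
  is_derive t (1 : R) ou_rate (ou_rate t * (2^-1 - (ou_var t)^-1)).
Proof.
move=> t0; have q0 := lt0r_neq0 (ou_var_gt0 t0).
have hP := is_derive_chain (is_derive_expR _)
  (is_derive_mulr 2^-1 (is_deriveNid t (1 : R))).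
apply: is_derive_eq (is_derive_div q0 hP (is_derive_ou_var t)) _.
by rewrite /ou_rate; field.
Qed.

Lemma ou_rate_sqr t : 0 < t -> ou_rate t ^+ 2 = (1 - ou_var t) / ou_var t ^+ 2.
Proof. by move=> t0; rewrite /ou_rate expr_div_n expR_half /ou_var subKr. Qed.

Lemma is_derive_ou_prec t : 0 < t ->
  is_derive t (1 : R) ou_prec (- (ou_rate t ^+ 2 / 2)).
Proof.
move=> t0; have q0 := lt0r_neq0 (ou_var_gt0 t0).
have q20 : 2 * ou_var t != 0 by rewrite mulf_neq0.
apply: is_derive_eq
  (is_derive_div (g := fun s => 2 * ou_var s) q20 (is_derive_expRN t)
    (is_derive_mull 2 (is_derive_ou_var t))) _.
have -> : expR (- t) = 1 - ou_var t by rewrite /ou_var subKr.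
by rewrite ou_rate_sqr //; field.
Qed.

(** The row index is the direction of differentiation, so that the derivative of the score along the
    row [v] is [v *m score_jacobian t x]. *)
Definition score_jacobian t x : 'M[R]_d :=
  \matrix_(k, i) (- ((k == i)%:R / ou_var t)
                  + ou_rate t ^+ 2 * post_cov (coord i) (coord k) t x).

Lemma score_jacobian_sym t x : (score_jacobian t x)^T = score_jacobian t x.
Proof. by apply/matrixP => i j; rewrite !mxE eq_sym post_covC. Qed.

Lemma mul_score_jacobian t x (y : 'rV[R]_d) i :
  (y *m score_jacobian t x) 0 i =
  - (y 0 i / ou_var t) + ou_rate t ^+ 2 * \sum_k y 0 k * post_cov (coord i) (coord k) t x.
Proof.
rewrite mxE (eq_bigr (fun k => - ((delta_mx 0 i : 'rV[R]_d) 0 k * (y 0 k / ou_var t))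
    + ou_rate t ^+ 2 * (y 0 k * post_cov (coord i) (coord k) t x))); last first.
  by move=> k _; rewrite !mxE eqxx /=; ring.
by rewrite big_split /= sumrN sum_delta_row mulr_sumr.
Qed.

(** The moving precision brings in the covariance of [y_i] with [|y|^2], a third-order quantity. The
    vanishing Laplacian replaces it by products of covariances and means, which the score and its
    Jacobian express. *)
Lemma is_derive_score_time t x i : 0 < t ->
  laplacian (optimal_denoiser p ^~ t) x = 0 ->
  is_derive t (1 : R) (fun s => score p x s 0 i)
    ((2^-1 *: score p x t +
      2^-1 *: ((x + 2 *: score p x t) *m score_jacobian t x)) 0 i).
Proof.
move=> t0 harm.
have q0 := lt0r_neq0 (ou_var_gt0 t0).
have r0 : ou_rate t != 0 by rewrite mulf_neq0 ?invr_eq0 // gt_eqF // expR_gt0.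
have {}harm : \sum_j post_cov (coord i) (coord j \* coord j) t x =
    \sum_j 2 * post_cov (coord i) (coord j) t x * post_mean (coord j) t x.
  have := laplacian_optimal_denoiser x i t0; rewrite harm mxE => /esym/eqP.
  have K : sigma t * ou_rate t ^+ 3 != 0.
    by rewrite mulf_neq0 ?expf_neq0 // gt_eqF // sigma_gt0.
  rewrite oppr_eq0 mulf_eq0 (negbTE K) /=.
  by rewrite sumrB subr_eq0 => /eqP.
have st : \forall s \near t, 0 < s by exact: lt_nbhsr.
have rP := is_derive_ou_rate t0.
have cdr : {for t, continuous (fun s => ou_rate s * (2^-1 - (ou_var s)^-1))}.
  have iP := is_derive_div q0 (is_derive_const 1 _ _) (is_derive_ou_var t).
  have -> : (fun s => ou_rate s * (2^-1 - (ou_var s)^-1)) =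
      (fun s => ou_rate s * (2^-1 - 1 / ou_var s)).
    by apply/funext => s; rewrite mul1r.
  exact: is_derive_continuous (is_derive_mul rP (is_derive_sub (is_derive_const 2^-1 _ _) iP)).
have cdtau : {for t, continuous (fun s => - (ou_rate s ^+ 2 / 2))}.
  have -> : (fun s => - (ou_rate s ^+ 2 / 2)) = (fun s => ou_rate s * ou_rate s * (- 2^-1)).
    by apply/funext => s; rewrite mulrN.
  exact: is_derive_continuous (is_derive_mulr (- 2^-1) (is_derive_mul rP rP)).
have nrP : \forall s \near t, is_derive s (1 : R) ou_rate
    (ou_rate s * (2^-1 - (ou_var s)^-1)).
  by apply: filterS st => s; exact: is_derive_ou_rate.
have nprecP : \forall s \near t, is_derive s (1 : R) ou_prec (- (ou_rate s ^+ 2 / 2)).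
  by apply: filterS st => s; exact: is_derive_ou_prec.
have mP := is_derive_post_mean_time x (exp_growth_coord i) t0 nrP nprecP cdr cdtau.
have xP := is_derive_div q0 (is_derive_const (- x 0 i) t 1) (is_derive_ou_var t).
(* The closed form of the score is valid only at positive times, so it is substituted near [t]. *)
apply: (@near_eq_is_derive _ _ _
  (fun s => - x 0 i / ou_var s + ou_rate s * post_mean (coord i) s x)).
  near=> s; rewrite score_entry ?mulNr //; by near: s.
have H := is_derive_add xP (is_derive_mul rP mP).
apply: is_derive_eq H _.
rewrite !lmxE mul_score_jacobian !lmxE.
under [in RHS]eq_bigr do rewrite !lmxE score_entry //.
rewrite score_entry // sumrB -mulr_sumr harm.
have -> : \sum_j ou_rate t * (2^-1 - (ou_var t)^-1) * x 0 j *
      post_cov (coord i) (coord j) t x =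
    ou_rate t * (2^-1 - (ou_var t)^-1) * \sum_j x 0 j * post_cov (coord i) (coord j) t x.
  by rewrite mulr_sumr; apply: eq_bigr => j _; ring.
have -> : \sum_j 2 * post_cov (coord i) (coord j) t x * post_mean (coord j) t x =
    2 * \sum_j post_mean (coord j) t x * post_cov (coord i) (coord j) t x.
  by rewrite mulr_sumr; apply: eq_bigr => j _; ring.
(* By Tweedie's formula [x + 2 s] has entries [(1 - 2 / q) x_j + 2 r m_j], with [r] the rate and [m]
   the posterior mean. *)
rewrite [in RHS](eq_bigr (fun j =>
  (1 - 2 / ou_var t) * (x 0 j * post_cov (coord i) (coord j) t x)
  + 2 * ou_rate t * (post_mean (coord j) t x * post_cov (coord i) (coord j) t x))); last first.
  by move=> j _; ring.
rewrite big_split /= -!mulr_sumr.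
by field.
Unshelve. all: by end_near. Qed.

End ornstein_uhlenbeck.

(** * One-sided differential calculus on the strip *)

Section scale_differential.
Context {R : realType} {V W : normedModType R}.

(** A named copy of scaling that carries a bilinear structure, from which the product rule for
    [k z *: f z] follows. *)
Definition scale_op (k : R) (v : V) : V := k *: v.

Lemma scale_op_is_bilinear : bilinear_for
  (GRing.Scale.Law.clone _ _ *:%R _) (GRing.Scale.Law.clone _ _ *:%R _) scale_op.
Proof.
split=> [v|k] a x y; rewrite /scale_op /=.
  by rewrite scalerDl scalerA.
by rewrite scalerDr !scalerA mulrC.
Qed.
HB.instance Definition _ := bilinear_isBilinear.Build R R V V _ _ scale_op
  scale_op_is_bilinear.

Lemma is_diff_scale (k : W -> R) (f : W -> V) dk df x :
  is_diff x k dk -> is_diff x f df ->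
  is_diff x (fun z => k z *: f z) (fun z => k x *: df z + dk z *: f x).
Proof.
move=> kP fP; have H : is_diff (k x, f x) (fun q => scale_op q.1 q.2)
    (fun q => scale_op (k x) q.2 + scale_op q.1 (f x)).
  have c : continuous (fun q : R * V => scale_op q.1 q.2) by exact: scale_continuous.
  by apply: DiffDef; [exact: differentiable_bilin|rewrite diff_bilin].
have := is_diff_comp (is_diff_pair kP fP) H.
by move=> /is_diff_eq; apply.
Qed.

Lemma is_diff_fst (x : V * W) : is_diff x fst fst.
Proof.
have c : continuous (@fst V W) by move=> z; exact: cvg_fst.
by apply: DiffDef; [exact: linear_differentiable|rewrite diff_lin].
Qed.

Lemma is_diff_snd (x : V * W) : is_diff x snd snd.
Proof.
have c : continuous (@snd V W) by move=> z; exact: cvg_snd.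
by apply: DiffDef; [exact: linear_differentiable|rewrite diff_lin].
Qed.

End scale_differential.

Section time_differential.
Context {R : realType} {V : normedModType R}.

Lemma is_diff_time (c : R -> R) dc (z : V * R) : is_derive (z.2) (1 : R) c dc ->
  is_diff z (fun w => c w.2) (fun w => w.2 * dc).
Proof.
move=> cP; have cD : is_diff (z.2) c (fun h => h * dc).
  apply: DiffDef; first by apply/derivable1_diffP; exact: ex_derive.
  rewrite deriv1E; last exact: ex_derive.
  by apply/funext => h; rewrite derive1E derive_val.
exact: is_diff_comp (is_diff_snd z) cD.
Qed.

End time_differential.

(** * Joint space-time derivatives on the closed strip *)

Section strip.
Context {R : realType} {d : nat} (T : R).
Implicit Types (f : 'rV[R]_d -> R -> 'rV[R]_d) (x v : 'rV[R]_d) (t : R).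
Implicit Types (J : 'M[R]_d).

(* At [t = T] this is a one-sided notion in time, like [smooth_on_strip]. *)
Definition strip_deriv f x t J (ft : 'rV[R]_d) : Prop :=
  exists g : 'rV[R]_d * R -> 'rV[R]_d,
    is_diff (x, t) g (fun z => z.1 *m J + z.2 *: ft) /\
    \forall z \near (x, t), 0 <= z.2 <= T -> f z.1 z.2 = g z.

(** The differential of the local extension splits by linearity into its restriction to [(v, 0)],
    represented by a matrix, and its value at [(0, 1)]. *)
Lemma strip_deriv_smooth f x t : smooth_on_strip T f -> 0 <= t <= T ->
  exists J ft, strip_deriv f x t J ft.
Proof.
move=> fs t0T; have [U [g [oU Ux gC fg]]] := fs x t t0T.
have dg : differentiable g (x, t) by have [+ _] := gC 1%N; exact.
pose h (v : 'rV[R]_d) := 'd g (x, t) (v, 0).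
have hlin : linear h.
  move=> a u v; rewrite /h -linearP; congr ('d g _ _).
  by rewrite -[RHS]/(a *: u + v, a *: 0 + 0) scaler0 addr0.
pose hL : {linear _ -> _} := HB.pack h (GRing.isLinear.Build _ _ _ _ h hlin).
exists (lin1_mx hL), ('d g (x, t) (0, 1)), g; split.
  apply: DiffDef => //; apply/funext => -[v s].
  transitivity (h v + s *: 'd g (x, t) (0, 1)); last first.
    by congr (_ + _); exact: (esym (mul_rV_lin1 hL v)).
  rewrite /h -linearZ -linearD; congr ('d g _ _).
  by rewrite -[RHS]/(v + s *: 0, 0 + s *: 1) scaler0 addr0 add0r [_%:A]mulr1.
apply: filterS (open_nbhs_nbhs (conj oU Ux)) => -[y s] Uy /=.
exact: fg.
Qed.

Lemma strip_deriv_eq f1 f2 x t J ft :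
  (forall y s, 0 <= s <= T -> f1 y s = f2 y s) ->
  strip_deriv f1 x t J ft -> strip_deriv f2 x t J ft.
Proof.
move=> f12 [g [gP fg]]; exists g; split=> //.
by apply: filterS fg => -[y s] /= fg sT; rewrite -f12 ?fg.
Qed.

Lemma strip_derivD f1 f2 x t J1 J2 ft1 ft2 :
  strip_deriv f1 x t J1 ft1 -> strip_deriv f2 x t J2 ft2 ->
  strip_deriv (fun y s => f1 y s + f2 y s) x t (J1 + J2) (ft1 + ft2).
Proof.
move=> [g1 [g1P fg1]] [g2 [g2P fg2]]; exists (g1 + g2); split.
  apply: is_diff_eq (is_diffD g1P g2P) _; apply/funext => z /=.
  by rewrite mulmxDr scalerDr addrACA.
by apply: filterS2 fg1 fg2 => z fg1 fg2 zT; rewrite fg1 // fg2.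
Qed.

Lemma strip_derivZt (c : R -> R) dc f x t J ft : 0 <= t <= T ->
  is_derive t (1 : R) c dc -> strip_deriv f x t J ft ->
  strip_deriv (fun y s => c s *: f y s) x t (c t *: J) (c t *: ft + dc *: f x t).
Proof.
move=> t0T cP [g [gP fg]]; exists (fun z => c z.2 *: g z); split; last first.
  by apply: filterS fg => z fg zT; rewrite fg.
rewrite (nbhs_singleton fg t0T).
apply: is_diff_eq (is_diff_scale (is_diff_time (z := (x, t)) cP) gP) _.
apply/funext => z /=.
by rewrite !scalerDr -scalemxAr !scalerA addrA [c t * _]mulrC.
Qed.

Lemma strip_derivZ c f x t J ft : strip_deriv f x t J ft ->
  strip_deriv (fun y s => c *: f y s) x t (c *: J) (c *: ft).
Proof.
move=> [g [gP fg]]; exists (c *: g); split.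
  apply: is_diff_eq (is_diffZ c gP) _; apply/funext => z /=.
  rewrite -[LHS]/(c *: (z.1 *m J + z.2 *: ft)).
  by rewrite scalerDr -scalemxAr !scalerA [c * _]mulrC.
by apply: filterS fg => z fg zT; rewrite fg.
Qed.

Lemma strip_derivN f x t J ft : strip_deriv f x t J ft ->
  strip_deriv (fun y s => - f y s) x t (- J) (- ft).
Proof.
rewrite -[- J]scaleN1r -[- ft]scaleN1r => /(strip_derivZ (-1)).
by apply: strip_deriv_eq => y s _; rewrite scaleN1r.
Qed.

Lemma strip_deriv_id x t : strip_deriv (fun y _ => y) x t 1%:M 0.
Proof.
exists fst; split; last by near=> z.
apply: is_diff_eq (is_diff_fst _) _; apply/funext => z.
by rewrite mulmx1 scaler0 addr0.
Unshelve. all: by end_near. Qed.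

(** The map [(y, s) -> (a y s, s)] keeps the time coordinate, so it sends the strip to itself and
    composing the two local extensions extends the composite. *)
Lemma strip_deriv_comp f a x t J ft Ja dta : 0 <= t <= T ->
  strip_deriv a x t Ja dta -> strip_deriv f (a x t) t J ft ->
  strip_deriv (fun y s => f (a y s) s) x t (Ja *m J) (dta *m J + ft).
Proof.
move=> t0T [ga [gaP aga]] [g [gP fg]].
have axt := nbhs_singleton aga t0T; rewrite /= in axt.
have pP := is_diff_pair gaP (is_diff_snd (x, t)).
have gP' : is_diff (ga (x, t), (x, t).2) g (fun z => z.1 *m J + z.2 *: ft).
  by rewrite -axt.
exists (g \o (fun z => (ga z, z.2))); split.
  apply: is_diff_eq (is_diff_comp pP gP') _; apply/funext => z /=.
  by rewrite mulmxDl scalerDr mulmxA -scalemxAl addrA.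
have c : {for (x, t), continuous (fun z : 'rV[R]_d * R => (ga z, z.2))}.
  by case: pP => dP _; exact: differentiable_continuous dP.
rewrite axt in fg.
have fg' := c _ fg.
apply: filterS2 aga fg' => z /= aga fg' zT; by rewrite aga // fg'.
Qed.

(** The constraint bears on time only: at fixed [t] the extension agrees with [f] at all nearby [y],
    so the spatial derivative is genuine even at [t = T]. *)
Lemma is_derive_strip f x t J ft v : 0 <= t <= T -> strip_deriv f x t J ft ->
  is_derive x v (f ^~ t) (v *m J).
Proof.
move=> t0T [g [gP fg]].
have pP : is_diff x (fun y : 'rV[R]_d => (y, t)) (fun y => (y, 0)).
  exact: is_diff_pair (is_diff_id x) (is_diff_cst t x).
have cP := is_diff_comp pP gP.
apply: (@near_eq_is_derive _ _ _ (g \o (fun y : 'rV[R]_d => (y, t)))).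
  have c : {for x, continuous (fun y : 'rV[R]_d => (y, t))}.
    by case: pP => dP _; exact: differentiable_continuous dP.
  have fg' : \forall y \near x, 0 <= t <= T -> f y t = g (y, t) := c _ fg.
  by near=> y; apply/esym; near: y; apply: filterS fg' => y; exact.
have [dP dE] := cP.
apply: DeriveDef; first exact: diff_derivable.
by rewrite deriveE // dE /= scale0r addr0.
Unshelve. all: by end_near. Qed.

(** * Time derivatives taken from within the interval *)

Section one_sided.
Variables (W : normedModType R) (t : R).
Hypothesis t0T : 0 < t <= T.

Local Notation strip_nbhs := (within [set s | 0 <= s <= T] t^').

#[local] Instance strip_nbhs_proper : ProperFilter strip_nbhs.
Proof.
apply: Build_ProperFilter_ex => P.
rewrite /within /= /dnbhs /within /= => /nbhs_ballP[e /= e0 eP].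
(* Half of the minimum keeps [s] positive, distinct from [t] and within [e] of it; moving left stays
   below [T]. *)
move: t0T => /andP[t0 tT]; pose s := t - Num.min e t / 2.
have m0 : 0 < Num.min e t by rewrite lt_min e0.
have me : Num.min e t <= e by rewrite ge_min lexx.
have mt : Num.min e t <= t by rewrite ge_min lexx orbT.
exists s; apply: eP.
- by rewrite /ball /= /s opprB addrC subrK ger0_norm; lra.
- by rewrite /s; apply/eqP => E; lra.
- by rewrite /= /s; apply/andP; split; lra.
Qed.

Lemma cvg_difference_quotient (f : R -> W) df : is_derive t (1 : R) f df ->
  (s - t)^-1 *: (f s - f t) @[s --> strip_nbhs] --> df.
Proof.
move=> fP; have /cvgrPdist_le H : (h^-1 *: (f (h *: 1 + t) - f t)) @[h --> 0^'] --> df.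
  by have := ex_derive (is_derive := fP); rewrite -(derive_val (is_derive := fP)).
apply/cvgrPdist_le => e e0; have := H e e0.
rewrite /within /= /dnbhs /within /= => /nbhs_ballP[k /= k0 kP].
apply/nbhs_ballP; exists k => //= s sk st _.
have := kP (s - t); rewrite [_%:A]mulr1 subrK; apply; last by rewrite subr_eq0.
by move: sk; rewrite /ball /= sub0r normrN distrC.
Qed.

(** Agreement at times of the strip suffices: both derivatives are limits of the same quotients
    along a proper filter in a Hausdorff space. *)
Lemma one_sided_derive_unique (f1 f2 : R -> W) df1 df2 :
  is_derive t (1 : R) f1 df1 -> is_derive t (1 : R) f2 df2 ->
  (\forall s \near t, 0 <= s <= T -> f1 s = f2 s) -> df1 = df2.
Proof.
move=> f1P f2P f12.
have f12t : f1 t = f2 t.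
  by apply: (nbhs_singleton f12); case/andP: t0T => /ltW -> ->.
apply: (cvg_unique (norm_hausdorff (V := W)) (cvg_difference_quotient f1P)).
apply: (cvg_trans _ (cvg_difference_quotient f2P)); apply: near_eq_cvg.
rewrite /within /= /dnbhs /within /=; apply: filterS f12 => s sE _ sT.
by rewrite sE // f12t.
Qed.

End one_sided.

Lemma is_derive_strip_time g x t J (ft : 'rV[R]_d) :
  is_diff (x, t) g (fun z => z.1 *m J + z.2 *: ft) ->
  is_derive t (1 : R) (fun s => g (x, s) : 'rV[R]_d) ft.
Proof.
move=> gP.
have pP : is_diff t (fun s : R => (x, s)) (fun s => (0, s)).
  exact: is_diff_pair (is_diff_cst x t) (is_diff_id t).
have [dP dE] := is_diff_comp pP gP.
apply: DeriveDef; first exact: diff_derivable.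
by rewrite deriveE // dE /= mul0mx add0r scale1r.
Qed.

Lemma near_strip_time f x t g : (\forall z \near (x, t), 0 <= z.2 <= T -> f z.1 z.2 = g z) ->
  \forall s \near t, 0 <= s <= T -> f x s = g (x, s).
Proof.
move=> fg.
have c : {for t, continuous (fun s : R => (x, s))}.
  have [dP _] : is_diff t (fun s : R => (x, s)) (fun s => (0, s)).
    exact: is_diff_pair (is_diff_cst x t) (is_diff_id t).
  exact: differentiable_continuous dP.
exact: c _ fg.
Qed.

Lemma dtime_strip f x t J ft : 0 < t <= T -> strip_deriv f x t J ft ->
  dtime T f x t = ft.
Proof.
move=> t0T [g [gP fg]].
have t0T' : 0 <= t <= T by case/andP: t0T => /ltW -> ->.
have fgt := near_strip_time fg.
have PF := strip_nbhs_proper t0T.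
rewrite /dtime; apply: cvg_lim; first exact: norm_hausdorff.
apply: (cvg_trans _ (cvg_difference_quotient (is_derive_strip_time gP))).
apply: near_eq_cvg.
rewrite /within /= /dnbhs /within /=; apply: filterS fgt => s sE _ sT.
by rewrite sE // (nbhs_singleton fg t0T').
Qed.

Lemma strip_deriv_time_entry f x t J ft i l : 0 < t <= T -> strip_deriv f x t J ft ->
  is_derive t (1 : R) (fun s => f x s 0 i) l -> ft 0 i = l.
Proof.
move=> t0T [g [gP fg]] lP.
have gi : is_derive t (1 : R) (fun s => g (x, s) 0 i) (ft 0 i).
  exact: is_derive_entry (is_derive_strip_time gP).
apply: (one_sided_derive_unique t0T gi lP).
by apply: filterS (near_strip_time fg) => s sE sT; rewrite sE.
Qed.

(** This is what permits differentiating an equation that holds only on the strip: the derivatives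
    of its two sides must coincide. *)
Lemma strip_deriv_unique f x t J1 J2 ft1 ft2 : 0 < t <= T ->
  strip_deriv f x t J1 ft1 -> strip_deriv f x t J2 ft2 -> J1 = J2 /\ ft1 = ft2.
Proof.
move=> t0T f1 f2; split.
  have t0T' : 0 <= t <= T by case/andP: t0T => /ltW -> ->.
  apply/row_matrixP => i; rewrite !rowE.
  have := is_derive_strip (delta_mx 0 i) t0T' f1.
  have := is_derive_strip (delta_mx 0 i) t0T' f2.
  by move=> /@derive_val <- /@derive_val <-.
by rewrite -(dtime_strip t0T f1) (dtime_strip t0T f2).
Qed.

End strip.

(** * Linear algebra of the guided score *)

Section algebra.
Context {R : realType} {d : nat}.
Implicit Types (u v x : 'rV[R]_d) (J M P : 'M[R]_d).

(** [P *m Ja^T = Ja *m M1 *m Ja^T] is a congruence of a symmetric matrix, likewise for [b], and the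
    last hypothesis writes [P] as a combination of the two. *)
Lemma guided_jacobian_sym (omega : R) P M1 M2 Ja Jb :
  P = Ja *m M1 -> P = Jb *m M2 -> M1^T = M1 -> M2^T = M2 ->
  (1 + omega) *: Ja - omega *: Jb = 1%:M -> P^T = P.
Proof.
move=> P1 P2 M1s M2s Jab.
have Pa : (P *m Ja^T)^T = P *m Ja^T.
  by rewrite P1 !trmx_mul trmxK M1s !mulmxA.
have Pb : (P *m Jb^T)^T = P *m Jb^T.
  by rewrite P2 !trmx_mul trmxK M2s !mulmxA.
have PE : P = (1 + omega) *: (P *m Ja^T) - omega *: (P *m Jb^T).
  by rewrite -[LHS]mulmx1 -trmx1 -Jab !(linearB, linearZ) /= .
by rewrite PE linearB !linearZ /= Pa Pb.
Qed.

(** Pointwise data: [At], [Bt] are partial time derivatives of the scores, [DA], [DB] total ones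
    along the shifted points. The last three hypotheses are the fixed point equation and its
    derivatives in space and time, where [1 - q] is the time derivative of [q]. The conclusion is
    that [S] obeys the same evolution equation as the two scores. *)
Lemma guided_score_identity (omega q : R) x dx dxt A B At Bt Jdx J1 J2 :
  q != 0 ->
  let a := x + omega *: dx in
  let b := x + (1 + omega) *: dx in
  let Ja := 1%:M + omega *: Jdx in
  let Jb := 1%:M + (1 + omega) *: Jdx in
  let DA := omega *: dxt *m J1 + At in
  let DB := (1 + omega) *: dxt *m J2 + Bt in
  let S := (1 + omega) *: A - omega *: B in
  let JS := (1 + omega) *: (Ja *m J1) - omega *: (Jb *m J2) in
  J1^T = J1 -> J2^T = J2 ->
  At = 2^-1 *: A + 2^-1 *: ((a + 2 *: A) *m J1) ->
  Bt = 2^-1 *: B + 2^-1 *: ((b + 2 *: B) *m J2) ->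
  dx = q *: (A - B) ->
  Jdx = q *: (Ja *m J1 - Jb *m J2) ->
  dxt = q *: (DA - DB) + (1 - q) *: (A - B) ->
  JS^T = JS /\
  (1 + omega) *: DA - omega *: DB = 2^-1 *: S + 2^-1 *: ((x + 2 *: S) *m JS).
Proof.
move=> q0 a b Ja Jb DA DB S JS J1s J2s AtE BtE dxE JdxE dxtE.
pose M1 := 1%:M + q *: J1; pose M2 := 1%:M + q *: J2; pose P := 1%:M + q *: JS.
have trE (N : 'M[R]_d) : (1%:M + q *: N)^T = 1%:M + q *: N^T.
  by rewrite linearD linearZ /= trmx1.
have M1s : M1^T = M1 by rewrite trE J1s.
have M2s : M2^T = M2 by rewrite trE J2s.
have PE1 : P = Ja *m M1.
  rewrite mulmxDr mulmx1 -scalemxAr; apply/matrixP => i j; rewrite !lmxE.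
  by have /matrixP/(_ i j) := JdxE; rewrite !lmxE => ->; ring.
have PE2 : P = Jb *m M2.
  rewrite mulmxDr mulmx1 -scalemxAr; apply/matrixP => i j; rewrite !lmxE.
  by have /matrixP/(_ i j) := JdxE; rewrite !lmxE => ->; ring.
have Jab : (1 + omega) *: Ja - omega *: Jb = 1%:M.
  by apply/matrixP => i j; rewrite !lmxE; ring.
have Ps := guided_jacobian_sym PE1 PE2 M1s M2s Jab.
split.
  apply: (scalerI q0); apply: (addrI 1%:M).
  by rewrite -trE.
pose E := (1 + omega) *: DA - omega *: DB
          - (2^-1 *: S + 2^-1 *: ((x + 2 *: S) *m JS)).
suff : q *: E = 0 by move=> /eqP; rewrite scaler_eq0 (negbTE q0) subr_eq0 => /eqP.
(* These are chosen so that [DA = al *m J1 + A / 2] and [DB = be *m J2 + B / 2], while the claimed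
   value of the left side is [ga *m JS + S / 2]. *)
pose al := omega *: dxt + 2^-1 *: (a + 2 *: A).
pose be := (1 + omega) *: dxt + 2^-1 *: (b + 2 *: B).
pose ga := 2^-1 *: (x + 2 *: S).
have alJ : al *m J1 = (omega *: dxt) *m J1 + 2^-1 *: ((a + 2 *: A) *m J1).
  by rewrite mulmxDl; congr (_ + _); rewrite scalemxAl.
have beJ : be *m J2 = ((1 + omega) *: dxt) *m J2 + 2^-1 *: ((b + 2 *: B) *m J2).
  by rewrite mulmxDl; congr (_ + _); rewrite scalemxAl.
have gaJ : ga *m JS = 2^-1 *: ((x + 2 *: S) *m JS) by rewrite scalemxAl.
have dxtE' i : dxt 0 i = q * (DA 0 i - DB 0 i) + (1 - q) * (A 0 i - B 0 i).
  by have /rowP/(_ i) := dxtE; rewrite !lmxE.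
have dxE' i : dx 0 i = q * (A 0 i - B 0 i) by have /rowP/(_ i) := dxE; rewrite !lmxE.
have AtE' i : At 0 i = 2^-1 * A 0 i + 2^-1 * ((a + 2 *: A) *m J1) 0 i.
  by rewrite AtE !lmxE.
have BtE' i : Bt 0 i = 2^-1 * B 0 i + 2^-1 * ((b + 2 *: B) *m J2) 0 i.
  by rewrite BtE !lmxE.
(* The time derivative of [a + q A = x + q S], combined with that equation itself to trade [a] for
   [x]. *)
have alE : al *m M1 = q *: E + ga *m P.
  rewrite !mulmxDr !mulmx1 -!scalemxAr alJ gaJ; apply/rowP => i.
  rewrite /E /al /ga /S /a !lmxE dxtE' dxE' !lmxE AtE' BtE' /a /b.
  by field.
have beE : be *m M2 = q *: E + ga *m P.
  rewrite !mulmxDr !mulmx1 -!scalemxAr beJ gaJ; apply/rowP => i.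
  rewrite /E /be /ga /S /b !lmxE dxtE' dxE' !lmxE AtE' BtE' /a /b.
  by field.
have abE : (1 + omega) *: al - omega *: be = ga.
  by apply/rowP => i; rewrite !lmxE; field.
(* Since [P = Ja *m M1 = Jb *m M2], these shifts cancel the term [ga *m P]. *)
pose eta := al - ga *m Ja; pose zeta := be - ga *m Jb.
have etaE : eta *m M1 = q *: E by rewrite mulmxBl alE -mulmxA -PE1 addrK.
have zetaE : zeta *m M2 = q *: E by rewrite mulmxBl beE -mulmxA -PE2 addrK.
have etazeta : (1 + omega) *: eta - omega *: zeta = 0.
  have -> : (1 + omega) *: eta - omega *: zeta =
      ((1 + omega) *: al - omega *: be) - ga *m ((1 + omega) *: Ja - omega *: Jb).
    rewrite (mulmxBr ga) -!scalemxAr.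
    by apply/rowP => i; rewrite !lmxE; ring.
  by rewrite Jab abE mulmx1 subrr.
(* [M1 *m Ja^T] is the transpose of [P], hence [P] itself by symmetry. *)
have qEa : q *: E *m Ja^T = eta *m P.
  by rewrite -etaE -mulmxA -{1}M1s -trmx_mul -PE1 Ps.
have qEb : q *: E *m Jb^T = zeta *m P.
  by rewrite -zetaE -mulmxA -{1}M2s -trmx_mul -PE2 Ps.
have JabT : (1 + omega) *: Ja^T - omega *: Jb^T = 1%:M.
  by rewrite -[RHS]trmx1 -Jab !(linearB, linearZ).
rewrite -[LHS]mulmx1 -JabT mulmxBr -!scalemxAr qEa qEb !scalemxAl -mulmxBl etazeta.
by rewrite mul0mx.
Qed.

End algebra.

(** * The mixing error *)

Section mixing.
Context {R : realType} {d : nat} (T : R).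
Implicit Types (f : 'rV[R]_d -> R -> 'rV[R]_d) (x : 'rV[R]_d) (t : R) (J : 'M[R]_d).

Lemma is_derive_strip_entry f x t J ft i k : 0 <= t <= T -> strip_deriv T f x t J ft ->
  is_derive x (delta_mx 0 i : 'rV[R]_d) (fun y => f y t 0 k) (J i k).
Proof.
move=> t0T /(is_derive_strip (delta_mx 0 i) t0T) /is_derive_entry - /(_ k).
by rewrite -rowE mxE.
Qed.

Lemma gradient_dotmul_id f x t J ft : 0 <= t <= T -> strip_deriv T f x t J ft ->
  gradient (fun y => dotmul (f y t) y) x = x *m J^T + f x t.
Proof.
move=> t0T fP; apply/rowP => i; rewrite mxE; apply: derive_val.
apply: is_derive_eq.
  apply: is_derive_bigsum => k.
  exact: is_derive_mul (is_derive_strip_entry i k t0T fP) (is_derive_coord x _ k).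
rewrite addmxE mxE big_split /=; congr (_ + _).
  by apply: eq_bigr => k _; rewrite mxE mulrC.
by rewrite -(sum_delta_row (f x t 0) i); apply: eq_bigr => k _; rewrite mulrC.
Qed.

Lemma gradient_norm2_sqr f x t J ft : 0 <= t <= T -> strip_deriv T f x t J ft ->
  gradient (fun y => norm2 (f y t) ^+ 2) x = 2 *: (f x t *m J^T).
Proof.
move=> t0T fP; apply/rowP => i; rewrite mxE; apply: derive_val.
have -> : (fun y => norm2 (f y t) ^+ 2) = (fun y => \sum_k f y t 0 k * f y t 0 k).
  apply/funext => y; rewrite /norm2 sqr_sqrtr // /dotmul.
  by apply: sumr_ge0 => k _; rewrite -expr2 sqr_ge0.
apply: is_derive_eq.
  apply: is_derive_bigsum => k.
  exact: is_derive_mul (is_derive_strip_entry i k t0T fP) (is_derive_strip_entry i k t0T fP).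
rewrite scalemxE mxE mulr_sumr; apply: eq_bigr => k _.
by rewrite mxE; ring.
Qed.

Lemma is_derive_sigma t : 0 < t ->
  is_derive t (1 : R) (@sigma R) ((1 - ou_var t) / (2 * sigma t)).
Proof.
move=> t0; have s0 := ou_var_gt0 t0.
have := is_derive_chain (is_derive1_sqrt s0) (is_derive_ou_var t).
by move=> /is_derive_eq; apply; rewrite mulrC.
Qed.

(** Both gradients produce [J^T]; symmetry turns them into products with [J], leaving an expression
    in the first-order data alone. *)
Lemma mixing_error_strip f x t J ft : 0 < t <= T ->
  strip_deriv T f x t J ft -> J^T = J -> laplacian (f ^~ t) x = 0 ->
  mixing_error T f x t = ft - 2^-1 *: (x *m J + f x t
    + ((1 - sigma t ^+ 2) / sigma t ^+ 2) *: f x t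
    - (2 / sigma t) *: (f x t *m J)).
Proof.
move=> t0T fP Js lap0; have t0T' : 0 <= t <= T by case/andP: t0T => /ltW -> ->.
rewrite /mixing_error /FP_operator (dtime_strip t0T fP) lap0 addr0.
rewrite (gradient_dotmul_id t0T' fP) (gradient_norm2_sqr t0T' fP) Js.
by rewrite scalerA [_^-1 * 2]mulrC.
Qed.

(** The moment formulas give separate partial derivatives only. Smoothness supplies a joint
    differential, whose blocks are then identified with those partials. *)
Lemma strip_deriv_score (p : 'rV[R]_d -> R) x t :
  positive_density p -> smooth_score T p -> 0 < t <= T ->
  laplacian (optimal_denoiser p ^~ t) x = 0 ->
  strip_deriv T (score p) x t (score_jacobian p t x)
    (2^-1 *: score p x t +
      2^-1 *: ((x + 2 *: score p x t) *m score_jacobian p t x)).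
Proof.
move=> dp [_ sp] t0T lap0; have t0T' : 0 <= t <= T by case/andP: t0T => /ltW -> ->.
have t0 : 0 < t by case/andP: t0T.
have [J [ft fP]] := strip_deriv_smooth x sp t0T'.
have JE : score_jacobian p t x = J.
  apply/matrixP => k i; have := is_derive_strip_entry k i t0T' fP.
  have := is_derive_score_space dp x (delta_mx 0 k) i t0.
  move=> /@derive_val sE /@derive_val; rewrite sE => <-.
  by rewrite sum_delta_row !mxE eqxx /= [k == i]eq_sym; ring.
have -> : 2^-1 *: score p x t + 2^-1 *: ((x + 2 *: score p x t) *m score_jacobian p t x) = ft.
  apply/rowP => i; apply/esym; apply: (strip_deriv_time_entry t0T fP).
  exact: is_derive_score_time.
by rewrite JE.
Qed.

Lemma guidance_mixing_error omega (s1 s2 dx : 'rV[R]_d -> R -> 'rV[R]_d) x t J1 J2 :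
  let a y s := y + omega *: dx y s in
  let b y s := y + (1 + omega) *: dx y s in
  let eps1 y s := - (sigma s *: s1 y s) in
  let eps2 y s := - (sigma s *: s2 y s) in
  let epsCH := characteristic_guidance omega eps1 eps2 dx in
  0 < t <= T ->
  smooth_on_strip T dx ->
  (forall y s, 0 <= s <= T -> dx y s = sigma s *: (eps2 (b y s) s - eps1 (a y s) s)) ->
  J1^T = J1 -> J2^T = J2 ->
  strip_deriv T s1 (a x t) t J1
    (2^-1 *: s1 (a x t) t + 2^-1 *: ((a x t + 2 *: s1 (a x t) t) *m J1)) ->
  strip_deriv T s2 (b x t) t J2
    (2^-1 *: s2 (b x t) t + 2^-1 *: ((b x t + 2 *: s2 (b x t) t) *m J2)) ->
  laplacian (epsCH ^~ t) x = 0 ->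
  mixing_error T epsCH x t = 0.
Proof.
move=> a b eps1 eps2 epsCH t0T smooth_dx dxE J1s J2s s1P s2P.
have t0T' : 0 <= t <= T by case/andP: t0T => /ltW -> ->.
have t0 : 0 < t by case/andP: t0T.
have q0 := lt0r_neq0 (ou_var_gt0 t0).
have s0 := lt0r_neq0 (sigma_gt0 t0).
pose S1 y s := s1 (a y s) s.
pose S2 y s := s2 (b y s) s.
have [Jdx [dxt dxP]] := strip_deriv_smooth x smooth_dx t0T'.
have aP := strip_derivD (strip_deriv_id T x t) (strip_derivZ omega dxP).
have bP := strip_derivD (strip_deriv_id T x t) (strip_derivZ (1 + omega) dxP).
have S1P : strip_deriv T S1 x t _ _ := strip_deriv_comp t0T' aP s1P.
have S2P : strip_deriv T S2 x t _ _ := strip_deriv_comp t0T' bP s2P.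
rewrite !add0r in S1P S2P.
(* The factor [sigma] of the fixed point equation meets the one in [eps = - sigma s], and the signs
   swap the difference. *)
have dxE' y s : 0 <= s <= T -> dx y s = ou_var s *: (S1 y s - S2 y s).
  move=> sT; have /rowP dxEi := dxE y s sT; apply/rowP => i.
  rewrite (dxEi i) -sigma_sqr; last by case/andP: sT.
  by rewrite /eps1 /eps2 !lmxE /S1 /S2; ring.
have qP := strip_derivZt t0T' (is_derive_ou_var t) (strip_derivD S1P (strip_derivN S2P)).
(* A second derivative of [dx], through the right side of its equation; equating it with the first
   gives the linearised fixed point equations. *)
have dxP2 : strip_deriv T dx x t _ _ := strip_deriv_eq (fun y s sT => esym (dxE' y s sT)) qP.
have [JdxE dxtE] := strip_deriv_unique t0T dxP dxP2.
have [JSs StE] := guided_score_identity q0 J1s J2s erefl erefl (dxE' x t t0T') JdxE dxtE.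
pose S y s := (1 + omega) *: S1 y s - omega *: S2 y s.
(* From here only the symmetry of the Jacobian of [S] and the evolution equation of [S] are
   retained. *)
have [JS [{}JSs SP]] : exists JS, JS^T = JS /\ strip_deriv T S x t JS
    (2^-1 *: S x t + 2^-1 *: ((x + 2 *: S x t) *m JS)).
  eexists; split; first exact: JSs.
  rewrite -StE.
  exact: strip_derivD (strip_derivZ (1 + omega) S1P) (strip_derivN (strip_derivZ omega S2P)).
have epsCHE : epsCH = (fun y s => - (sigma s *: S y s)).
  apply/funext => y; apply/funext => s; apply/rowP => i.
  by rewrite /epsCH /characteristic_guidance /eps1 /eps2 /S /S1 /S2 !lmxE; ring.
have eP := strip_derivN (strip_derivZt t0T' (is_derive_sigma t0) SP).
rewrite epsCHE => lap0.
rewrite (mixing_error_strip t0T eP) //; last by rewrite linearN linearZ /= JSs.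
rewrite -(sigma_sqr (ltW t0)).
apply/rowP => i; rewrite !mulmxN !mulNmx -!scalemxAr -!scalemxAl mulmxDl -!scalemxAl !lmxE.
by rewrite [RHS]mxE; field.
Qed.

End mixing.

(** * Conclusion for the two optimal denoisers *)

Theorem theorem5p3 (R : realType) (d : nat) (T omega : R)
    (p_cond p : 'rV[R]_d -> R) (dx : 'rV[R]_d -> R -> 'rV[R]_d)
    (d_ge1 : (1 <= d)%N) (T_gt0 : 0 < T) (omega_gt0 : 0 < omega)
    (density_p_cond : positive_density p_cond)
    (density_p : positive_density p)
    (smooth_p_cond : smooth_score T p_cond)
    (smooth_p : smooth_score T p) :
  let eps1 := optimal_denoiser p_cond in
  let eps2 := optimal_denoiser p in
  let epsCH := characteristic_guidance omega eps1 eps2 dx in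
  smooth_on_strip T dx ->
  (forall x t, 0 <= t <= T ->
     dx x t = sigma t *: (eps2 (x + (1 + omega) *: dx x t) t
                          - eps1 (x + omega *: dx x t) t)) ->
  harmonic_ansatz T eps1 -> harmonic_ansatz T eps2 ->
  harmonic_ansatz T epsCH ->
  forall x t, 0 < t <= T -> mixing_error T epsCH x t = 0.
Proof.
move=> eps1 eps2 epsCH smooth_dx dxE harm1 harm2 harmCH x t t0T.
apply: (guidance_mixing_error t0T smooth_dx dxE (score_jacobian_sym p_cond _ _)
  (score_jacobian_sym p _ _)).
- exact: strip_deriv_score density_p_cond smooth_p_cond t0T (harm1 _ _ t0T).
- exact: strip_deriv_score density_p smooth_p t0T (harm2 _ _ t0T).
- exact: harmCH.
Qed.
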